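(* Let $(N,G)$ be a nearly ordered permutation group which is highly interval-transitive. (1) Let $H$ be a nontrivial subnormal subgroup of $G$. Then (a) $(\bar N,H)$ is highly approximately $o$-transitive; (b) if $G$ has a nonidentity bounded element, so does $H$. (2) Suppose $(N,G)$ is linear or monotonic and has a nonidentity bounded element. Let $a_1<\dots<a_n$ in $\bar N$, let $J_1<\dots<J_n$ be bounded $N$-intervals, and let $K$ be a bounded $N$-interval containing all the $a_i$ and all the $J_i$. Then there exists $g\in G$ with $g(a_i)\in\bar J_i$ for $i=1,\ldots,n$ and $\mathrm{supp}(g)\subseteq\bar K$. (3) Suppose $(N,G)$ is circular or monocircular and has a nonidentity bounded element. Let $\mathrm{Cr}(a_1,\ldots,a_n)$ in $\bar N$ and let $J_1,\ldots,J_n$ be bounded $N$-intervals with $\mathrm{Crs}(J_1,\ldots,J_n)$. (a) If $K$ is a bounded $N$-interval with $\mathrm{Cr}(\mathrm{cw}(K),a_1,\ldots,a_n,\mathrm{ccw}(K))$ and $\mathrm{Crs}(\{\mathrm{cw}(K)\},J_1,\ldots,J_n,\{\mathrm{ccw}(K)\})$, then there exists $g\in G$ with $g(a_i)\in\bar J_i$ for all $i$ and $\mathrm{supp}(g)\subseteq\bar K$. (b) There exists $g\in\mathrm{nBdd}(G)$ with $g(a_i)\in\bar J_i$ for $i=1,\ldots,n$.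
   Context: Let $L$ be a dense linear order. A nearly ordered permutation group $(N,G)$, $G\le\mathrm{Aut}(N)$, is linear ($N=(L,<)$, $L$ without endpoints, order-preserving bijections), monotonic ($N=\mathrm{ED}(L)$, $L$ without endpoints, order-preserving or order-reversing bijections), circular ($N=(L,\mathrm{Cr})$, $L$ with at most one endpoint, $\mathrm{Cr}(x,y,z)$ iff $x<y<z$ or $y<z<x$ or $z<x<y$; $\mathrm{Cr}$-preserving bijections) or monocircular (bijections preserving or reversing $\mathrm{Cr}$). $\bar N$ is the Dedekind completion of the same type; elements of $G$ extend uniquely to $\bar N$. For an $N$-interval $I$, $\bar I$ is the $\bar N$-interval with $\bar I\cap N=I$. $\mathrm{supp}(g)=\{x\in\bar N:g(x)\ne x\}$; $g$ is bounded if its support lies in a bounded $\bar N$-interval. Bounded intervals: $(x,y)$, $x<y$ (linear/monotonic), $(x,y)=\{z:\mathrm{Cr}(x,z,y)\}$, $x\ne y$ (circular); for a circular bounded interval $K=(x,y)$, $\mathrm{cw}(K)=x$ and $\mathrm{ccw}(K)=y$. $\mathrm{Cr}(x_1,\ldots,x_n)$ iff $\mathrm{Cr}(x_i,x_j,x_k)$ for all $i<j<k$; $\mathrm{Crs}(I_1,\ldots,I_n)$ iff the $I_k$ are nonempty and $\mathrm{Cr}(x_1,\ldots,x_n)$ whenever $x_k\in I_k$ (for $n\le2$: $\mathrm{Cr}(x_1,x_2)$ means distinct, $\mathrm{Crs}(I_1,I_2)$ disjoint). $n$-interval-transitive: for $N$-intervals $I_1<\dots<I_n$, $J_1<\dots<J_n$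 (resp. with $\mathrm{Crs}$) some $g\in G$ has $g(I_k)\cap J_k\ne\emptyset$ for all $k$; approximately $n$-$o$-transitive on $\bar N$: for $a_1<\dots<a_n$ in $\bar N$ and $\bar N$-intervals $J_1<\dots<J_n$ (resp. $\mathrm{Cr}$/$\mathrm{Crs}$) some $g$ has $g(a_k)\in J_k$; ''highly'' = for all $n$. In the circular cases, $\mathrm{1Bdd}(G)$ is the set of bounded elements and $\mathrm{nBdd}(G)$ the set of products of $n$ elements of $\mathrm{1Bdd}(G)$ (here $n$ is the number of points $a_i$). *)

(* Defs.v *)
From HB Require Import structures.
From mathcomp Require Import all_boot all_order.
From mathcomp Require Import boolp classical_sets.

Set Implicit Arguments.
Unset Strict Implicit.
Unset Printing Implicit Defensive.

Import Order.TTheory.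
Local Open Scope order_scope.
Local Open Scope classical_set_scope.

Variant kind := Linear | Monotonic | Circular | Monocircular.

Definition is_circ (k : kind) : bool :=
  match k with Circular | Monocircular => true | _ => false end.

Section Structure.
Context {d : Order.disp_t} {T : orderType d}.
Implicit Types (x y z : T) (k : kind).

Definition cr x y z : bool := [|| x < y < z, y < z < x | z < x < y].

(* Automorphisms of (T, <), ED(T), (T, Cr), and the bijections of T that
   preserve or reverse Cr. *)
Definition nearly_auto k (g : T -> T) : Prop :=
  bijective g /\
  match k with
  | Linear => forall x y, (g x < g y) = (x < y)
  | Monotonic => (forall x y, (g x < g y) = (x < y)) \/
                 (forall x y, (g y < g x) = (x < y))
  | Circular => forall x y z, cr (g x) (g y) (g z) = cr x y z
  | Monocircular => (forall x y z, cr (g x) (g y) (g z) = cr x y z) \/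
                    (forall x y z, cr (g z) (g y) (g x) = cr x y z)
  end.

(* The pairwise clause is implied by the other one as soon as 3 <= n; for
   n <= 2 it is the convention that Cr(x1, x2) means x1 <> x2. *)
Definition Cr n (a : n.-tuple T) : Prop :=
  (forall i j : 'I_n, (i < j)%N -> tnth a i <> tnth a j) /\
  (forall i j l : 'I_n, (i < j)%N -> (j < l)%N ->
     cr (tnth a i) (tnth a j) (tnth a l)).

Definition Crs n (I : n.-tuple (set T)) : Prop :=
  (forall i, tnth I i !=set0) /\
  (forall x : n.-tuple T, (forall i, tnth I i (tnth x i)) -> Cr x).

Definition increasing n (a : n.-tuple T) : Prop :=
  forall i j : 'I_n, (i < j)%N -> tnth a i < tnth a j.

Definition increasing_sets n (I : n.-tuple (set T)) : Prop :=
  forall i j : 'I_n, (i < j)%N ->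
    forall x y, tnth I i x -> tnth I j y -> x < y.

Definition ordered k n (a : n.-tuple T) : Prop :=
  if is_circ k then Cr a else increasing a.

Definition ordered_sets k n (I : n.-tuple (set T)) : Prop :=
  if is_circ k then Crs I else increasing_sets I.

Definition oitv k x y : set T :=
  if is_circ k then [set z | cr x z y] else [set z | x < z < y].

Definition proper_ends k x y : Prop :=
  if is_circ k then x <> y else x < y.

Definition bounded_interval k (I : set T) : Prop :=
  exists x y, proper_ends k x y /\ I = oitv k x y.

Definition is_interval k (I : set T) : Prop :=
  [\/ bounded_interval k I, I = setT |
      ~~ is_circ k /\ exists x, I = [set z | z < x] \/ I = [set z | x < z]].

Definition dense_order : Prop := forall x y, x < y -> exists z, x < z < y.

Definition endpoint x : Prop := (forall y, x <= y) \/ (forall y, y <= x).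

Definition ends_ok k : Prop :=
  if is_circ k then forall x y, endpoint x -> endpoint y -> x = y
  else forall x, ~ endpoint x.

End Structure.

Arguments dense_order {d} T.
Arguments ends_ok {d} T k.

(* A point of the completion is a lower set without maximum; x in L corresponds
   to its set of strict predecessors. In the linear case both infinities are
   left out. On the circle they are one and the same point of the completion:
   the cut setT is never used, and set0 is used unless L has a maximum, which
   is then already that point (if L has a minimum, set0 is that minimum). The
   circular order of the completion is derived from inclusion by the formula
   deriving Cr from < on L. *)
Definition is_cut (k : kind) d (L : orderType d) (A : set L) : Prop :=
  [/\ forall x y : L, x < y -> A y -> A x,
      forall x, A x -> exists2 y, A y & x < y,
      A <> setT &
      A = set0 -> is_circ k /\ ~ exists x : L, forall y, y <= x].

Definition completion (k : kind) d (L : orderType d) : Type :=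
  {A : set L | `[< is_cut k A >]}.

HB.instance Definition _ k d (L : orderType d) :=
  SubType.on (completion k L).
HB.instance Definition _ k d (L : orderType d) :=
  [Choice of completion k L by <:].
HB.instance Definition _ k d (L : orderType d) :=
  [SubChoice_isSubPOrder of completion k L by <: with set_display].

Lemma completion_total k d (L : orderType d) :
  total (<=%O : rel (completion k L)).
Proof.
move=> A B; rewrite -!Order.le_val.
have /asboolP [lA _ _ _] := valP A; have /asboolP [lB _ _ _] := valP B.
have [AB|] := pselect (val A `<=` val B); first by apply/orP; left; apply/subsetPset.
move=> /existsNP [x /not_implyP [Ax nBx]].
apply/orP; right; apply/subsetPset => y By.
case: (ltgtP x y) => [xy|yx|xy]; last by rewrite -xy.
- by case: nBx; exact: lB xy By.
- exact: lA yx Ax.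
Qed.

HB.instance Definition _ k d (L : orderType d) :=
  Order.POrder_isTotal.Build set_display (completion k L)
    (@completion_total k d L).

Section NearlyOrderedGroups.
Context (k : kind) {d : Order.disp_t} {L : orderType d}.
Implicit Types (g h : L -> L) (G H : set (L -> L)) (I J K : set L).

Local Notation N := L.
Local Notation Nbar := (completion k L).

Definition is_point (c : Nbar) (x : L) : Prop := val c = [set z | z < x].

(* A subset of N seen as a subset of the completion. *)
Definition inbar I : set Nbar := [set c | exists2 x, I x & is_point c x].

(* The unique extension of an automorphism g of N to the completion. *)
Definition ext g : Nbar -> Nbar :=
  @xget (Nbar -> Nbar) id
    [set gb | nearly_auto k gb /\
              forall c x, is_point c x -> is_point (gb c) (g x)].

Definition supp g : set Nbar := [set c | ext g c <> c].

Definition bounded_elt g : Prop :=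
  exists2 I, bounded_interval k I & supp g `<=` I.

(* Intervals of N may have their ends in the completion; endpoints_of K x y
   reads K = (x, y) in N, so that, on the circle, cw(K) = x and ccw(K) = y. *)
Definition endpoints_of K (x y : Nbar) : Prop :=
  proper_ends k x y /\ inbar K = oitv k x y `&` inbar setT.

Definition bounded_Ninterval K : Prop := exists x y, endpoints_of K x y.

Definition Ninterval I : Prop :=
  exists2 Ib : set Nbar, is_interval k Ib & inbar I = Ib `&` inbar setT.

(* The unique Nbar-interval that meets N in I. *)
Definition bar I : set Nbar :=
  xget set0 [set Ib | is_interval k Ib /\ inbar I = Ib `&` inbar setT].

Record perm_group G : Prop := PermGroup {
  perm_group1 : G id;
  perm_groupM : forall g h, G g -> G h -> G (g \o h);
  perm_groupV : forall g, G g -> exists h, [/\ G h, cancel g h & cancel h g]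
}.

Definition normal_in H G : Prop :=
  [/\ perm_group H, H `<=` G &
      forall g gV h, G g -> cancel g gV -> cancel gV g -> H h ->
        H (g \o h \o gV)].

Inductive subnormal G : set (L -> L) -> Prop :=
| subnormal_refl : subnormal G G
| subnormal_step H G' : subnormal G G' -> normal_in H G' -> subnormal G H.

Record nearly_ordered_group G : Prop := NearlyOrderedGroup {
  nog_dense : dense_order L;
  nog_ends : ends_ok L k;
  nog_group : perm_group G;
  nog_auto : forall g, G g -> nearly_auto k g
}.

Definition interval_transitive n G : Prop :=
  forall I J : n.-tuple (set N),
    (forall i, Ninterval (tnth I i)) -> (forall i, Ninterval (tnth J i)) ->
    ordered_sets k I -> ordered_sets k J ->
    exists2 g, G g & forall i, (g @` tnth I i) `&` tnth J i !=set0.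

Definition highly_interval_transitive G : Prop :=
  forall n, interval_transitive n G.

Definition approx_o_transitive n G : Prop :=
  forall (a : n.-tuple Nbar) (J : n.-tuple (set Nbar)),
    (forall i, is_interval k (tnth J i)) -> ordered k a -> ordered_sets k J ->
    exists2 g, G g & forall i, tnth J i (ext g (tnth a i)).

Definition highly_approx_o_transitive G : Prop :=
  forall n, approx_o_transitive n G.

Definition has_bounded G : Prop :=
  exists g, [/\ G g, g <> id & bounded_elt g].

Definition Bdd1 G : set (L -> L) := [set g | G g /\ bounded_elt g].

Definition nBdd n G : set (L -> L) :=
  [set g | exists2 s : n.-tuple (L -> L),
             forall i, Bdd1 G (tnth s i) & g = foldr (fun f h => f \o h) id s].

End NearlyOrderedGroups.

Arguments inbar k {d L} I _.
Arguments supp k {d L} g _.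
Arguments bar k {d L} I _.
Arguments endpoints_of k {d L} K x y.
Arguments ext {k d L} g c.

(* Main.v *)
(* The linear and the circular cases are treated together: a circle cut at a
   point [e] is a line, so in both cases one argues in a dense total order
   without endpoints.  Interval-transitivity, applied to intervals on both sides
   of each point, moves points of the completion approximately.

   Let [h] belong to a normal subgroup and move [w] to the right along a line.
   Near [w] there are disjoint intervals [B_1 < ... < B_n < h B_1 < ... < h B_n].
   If the points [a_i] lie to the left of the targets [J_i], some [g] in the
   group makes [g B_i] contain [a_i] and sends [h B_i] into [J_i], so that the
   conjugate [g h g^-1] sends [a_i] into [J_i].  When [h] has bounded support,
   [g] can moreover be chosen to squeeze this support into any interval that
   contains all the [a_i] and [J_i].  Arbitrary targets on the line are reached
   in two such moves, first far to the right and then back by the inverse of a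
   move; two different lines are linked through a small interval lying in both.
   An orientation-reversing [h] is first replaced by a commutator.  Commutators
   also give bounded elements of normal subgroups, and in the circular case the
   points are brought to their targets one at a time by bounded elements. *)

Require Import Defs.
From mathcomp Require Import all_boot all_order.
From mathcomp Require Import boolp classical_sets.
From mathcomp Require Import zify.

Set Implicit Arguments.
Unset Strict Implicit.
Unset Printing Implicit Defensive.

Import Order.TTheory.
Local Open Scope order_scope.
Local Open Scope classical_set_scope.

(** * Linear and circular orders *)

(** [lt3] depends on the base of a line, whereas [btw] mentions no base and is carried along by
    every orientation-preserving map. A group element need not send the base of one line to the base
    of another, so facts are transported by rewriting [lt3] into [btw], applying the map, and
    returning to [lt3] along the other line. The second obstacle is orientation.
    Interval-transitivity does not tell whether the element it provides reverses the order, and on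
    the circle three points whose images come in the same order are needed to exclude this. Hence
    [point_transitive m] asks for at least [m] points: two for the given group, none for its
    nontrivial normal subgroups, because the conjugating elements used there come with two auxiliary
    points of their own. *)

Section CyclicOrder.
Context {d : Order.disp_t} {T : orderType d}.
Implicit Types (k : kind) (x y z e c : T).

Lemma rank_in (s : seq T) : exists r : T -> nat, forall x, x \in s ->
  forall y, y \in s -> ((x < y) = (r x < r y)%N) /\ ((x == y) = (r x == r y)).
Proof.
pose t := sort <=%O (undup s).
have ts : sorted <%O t by rewrite sort_lt_sorted undup_uniq.
have tE x : (x \in t) = (x \in s) by rewrite mem_sort mem_undup.
have lt_index := sorted_ltn_index lt_trans ts.
exists (index^~ t) => x; rewrite -tE => xt y; rewrite -tE => yt.
case: (ltngtP (index x t) (index y t)) => [/lt_index|/lt_index|xy].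
- by move=> /(_ xt yt) xy; rewrite xy lt_eqF.
- by move=> /(_ yt xt) yx; rewrite gt_eqF // ltNge ltW.
- by rewrite -(nth_index x xt) xy nth_index // ltxx eqxx.
Qed.

(* The order of the circle cut at [e], on the points other than [e] (see [off]);
   in the linear case [e] plays no role. *)
Definition lt3 k e x y := if is_circ k then cr e x y else x < y.
(* [z] lies between [x] and [y]. *)
Definition btw k x y z := if is_circ k then cr x z y else x < z < y.
Definition valid_ends k x y := if is_circ k then x != y else x < y.
Definition off k e x := is_circ k ==> (x != e).

Lemma oitvE k x y z : oitv k x y z = btw k x y z.
Proof. by rewrite /oitv /btw; case: (is_circ k). Qed.

Lemma endsE k x y : proper_ends k x y <-> valid_ends k x y.
Proof.
by rewrite /proper_ends /valid_ends; case: (is_circ k) => //; split => /eqP.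
Qed.
End CyclicOrder.

(* Facts about finitely many points of a total order, or of a circular one, are
   transported to [nat] by a ranking of these points. *)
Ltac ordlia k s :=
  (* Only the hypotheses that the caller has moved back into the goal are transported; the others
     still speak of points of [T] and are dropped. *)
  repeat match goal with H : is_true _ |- _ => clear H end;
  rewrite /btw /valid_ends /off /lt3 /cr; case: (is_circ k) => /=;
  let r := fresh "r" in let E := fresh "E" in
  have [r E] := rank_in s;
  let go := (rewrite !inE ?eqxx ?orbT //) in
  do ?[rewrite (proj1 (E _ _ _ _)); [|by go|by go]];
  do ?[rewrite (proj2 (E _ _ _ _)); [|by go|by go]];
  clear E; lia.

Section Lines.
Context {d : Order.disp_t} {T : orderType d} (k : kind).
Implicit Types (x y z e c p q u v w : T).

Lemma lt3_off e x y : lt3 k e x y -> off k e x && off k e y.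
Proof. ordlia k [:: e; x; y]. Qed.

Lemma lt3_offl e x y : lt3 k e x y -> off k e x.
Proof. by case/lt3_off/andP. Qed.

Lemma lt3_offr e x y : lt3 k e x y -> off k e y.
Proof. by case/lt3_off/andP. Qed.

Lemma lt3_irr e x : lt3 k e x x = false.
Proof. ordlia k [:: e; x]. Qed.

Lemma lt3_trans e y x z : lt3 k e x y -> lt3 k e y z -> lt3 k e x z.
Proof. ordlia k [:: e; x; y; z]. Qed.

Lemma lt3_asym e x y : lt3 k e x y -> ~~ lt3 k e y x.
Proof. ordlia k [:: e; x; y]. Qed.

Lemma lt3_total e x y : off k e x -> off k e y ->
  [\/ lt3 k e x y, x = y | lt3 k e y x].
Proof.
move=> ex ey; have : [|| lt3 k e x y, x == y | lt3 k e y x].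
  move: ex ey; ordlia k [:: e; x; y].
by case/or3P => [|/eqP|]; [constructor 1|constructor 2|constructor 3].
Qed.

Lemma btw_lt3 e p q z : lt3 k e p q ->
  btw k p q z = lt3 k e p z && lt3 k e z q.
Proof. ordlia k [:: e; p; q; z]. Qed.

Lemma lt3_ends e p q : lt3 k e p q -> valid_ends k p q.
Proof. ordlia k [:: e; p; q]. Qed.
(** The point [z1] shows that, starting from [p], one meets [r] no later than [z1], hence before
    [q]. This serves to find a common point of two intervals with the same end. *)
Lemma btw_split_l p q r z1 z2 : valid_ends k p r -> btw k p q z1 ->
  ~~ btw k p r z1 -> btw k p r z2 -> btw k p q z2.
Proof.
move=> pr pz1 rz1; have rq : (r == q) || btw k p q r.
  by move: pr pz1 rz1; ordlia k [:: p; q; r; z1].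
by move: rq; ordlia k [:: p; q; r; z2].
Qed.

Lemma btw_split_r p q r z1 z2 : valid_ends k r p -> btw k q p z1 ->
  ~~ btw k r p z1 -> btw k r p z2 -> btw k q p z2.
Proof.
move=> pr pz1 rz1; have rq : (r == q) || btw k q p r.
  by move: pr pz1 rz1; ordlia k [:: p; q; r; z1].
by move: rq; ordlia k [:: p; q; r; z2].
Qed.

Lemma cr_below e x y : x < e -> cr e x y -> (y < e) * (x < y).
Proof.
by rewrite /cr => xe; rewrite (lt_gtF xe) andbF orbF => /andP[-> ->].
Qed.

Lemma cr_above e x y : e < x -> e < y -> cr e x y -> x < y.
Proof.
by rewrite /cr => ex ey; rewrite (lt_gtF ey) andbF !orbF => /andP[_].
Qed.
End Lines.

(** * The completion *)

(** Orders with at most one point are excluded: on a one-point circle the empty set of predecessors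
    is no cut, since the point is a maximum. *)
Definition ample (k : kind) d (L : orderType d) : Prop :=
  [/\ dense_order L, ends_ok L k & exists x y : L, x < y].

Section Completion.
Context {k : kind} {d : Order.disp_t} {L : orderType d}.
Local Notation X := (completion k L).
Implicit Types (x y z : L) (c p q u v w : X).

Lemma cutP c : is_cut k (val c). Proof. by have /asboolP := valP c. Qed.

Lemma cut_ltP p q : reflect (exists2 x, val q x & ~ val p x) (p < q).
Proof.
rewrite ltNge -Order.le_val; apply: (iffP negP) => [pq|[x qx px] /subsetPset/(_ x qx)//].
by apply: contrapT => ne; apply: pq; apply/subsetPset => x qx; apply: contrapT => px; apply: ne; exists x.
Qed.

Definition of_cut (A : set L) (Acut : is_cut k A) : X :=
  exist (fun A : set L => is_true `[< is_cut k A >]) A (asboolT Acut).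

Hypothesis HL : ample k L.

(** Only emptiness is at stake. It makes [x] a minimum, which the linear kinds forbid; on the circle
    a maximum would be a second endpoint, hence equal to [x], although [L] has two points. *)
Lemma pt_cut x : is_cut k [set z | z < x].
Proof.
have [dL eL [y [y' yy']]] := HL; split.
- by move=> z t zt /= /(lt_trans zt).
- by move=> z /= /dL [t /andP[zt tx]]; exists t.
- by move=> /seteqP [_ /(_ x I)] /=; rewrite ltxx.
move=> x0; have xmin z : x <= z.
  by rewrite leNgt; apply/negP => zx; have : [set z | z < x] z by []; rewrite x0.
move: eL; rewrite /ends_ok; case: (is_circ k) => eL; last by case: (eL x); left.
split=> // -[z zmax]; have xz : x = z by apply: eL; [left|right].
by have := lt_le_trans yy' (zmax y'); rewrite ltNge -xz xmin.
Qed.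

Definition pt x : X := of_cut (pt_cut x).

Lemma pt_point c x : is_point c x <-> c = pt x.
Proof. by split=> [cx|-> //]; apply: val_inj. Qed.

Lemma lt_pt x c : (pt x < c) <-> val c x.
Proof.
have [lc _ _ _] := cutP c; split=> [/cut_ltP [y cy /= /negP]|cx].
  by rewrite -leNgt le_eqVlt => /predU1P [->|/lc]//; apply.
by apply/cut_ltP; exists x => //=; rewrite ltxx.
Qed.

Lemma le_pt x c : (c <= pt x) <-> ~ val c x.
Proof. by rewrite leNgt; split=> [/negP cx /lt_pt//|cx]; apply/negP => /lt_pt. Qed.

Lemma pt_lt x y : (pt x < pt y) = (x < y).
Proof. by apply/idP/idP => [/lt_pt|xy]; last exact/lt_pt. Qed.

Lemma pt_eq x y : (pt x == pt y) = (x == y).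
Proof. by case: (ltgtP x y) => [xy|yx|->]; [rewrite lt_eqF ?pt_lt|rewrite gt_eqF ?pt_lt|rewrite eqxx]. Qed.

Lemma cut_dense p q : p < q -> exists z, p < pt z < q.
Proof.
move=> /cut_ltP [x qx px]; have [_ + _ _] := cutP q.
move=> /(_ x qx) [y qy xy]; exists y; apply/andP; split; last exact/lt_pt.
by apply: le_lt_trans (_ : p <= pt x) _; [apply/le_pt|rewrite pt_lt].
Qed.

(** An arc that wraps round infinity contains a point above [p] or below [q], unless [q] is the
    empty cut and [p] the cut of a maximum of [L]; the definition of cuts does not allow these two
    together. *)
Lemma btw_ex p q : valid_ends k p q -> exists z, btw k p q (pt z).
Proof.
rewrite /valid_ends /btw; case ck: (is_circ k); last exact: cut_dense.
case: (ltgtP p q) => // [pq _|qp _].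
  by have [z pzq] := cut_dense pq; exists z; rewrite /cr pzq.
have [|ne] := pselect (exists z, (p < pt z) || (pt z < q)).
  by case=> z pzq; exists z; rewrite /cr qp; case/orP: pzq => ->; rewrite ?andbT ?orbT.
have [lp _ /eqP pT _] := cutP p; have [_ _ _ q0] := cutP q.
have [z pz] : exists z, ~ val p z.
  by apply: contrapT => /forallNP np; case/eqP: pT; apply/seteqP; split=> // z _; apply: contrapT => /np.
have /q0 [_ []] : val q = set0.
  by apply/seteqP; split=> // t qt; case: ne; exists t; apply/orP; right; apply/lt_pt.
exists z => t; rewrite leNgt; apply/negP => zt; case: ne; exists t; apply/orP; left.
by apply: le_lt_trans (_ : pt z < _); [apply/le_pt|rewrite pt_lt].
Qed.

Lemma cr_pt x y z : cr (pt x) (pt y) (pt z) = cr x y z.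
Proof. by rewrite /cr !pt_lt. Qed.

Lemma lt3_pt x y z : lt3 k (pt x) (pt y) (pt z) = lt3 k x y z.
Proof. by rewrite /lt3 cr_pt pt_lt. Qed.

Lemma off_pt x y : off k (pt x) (pt y) = off k x y.
Proof. by rewrite /off pt_eq. Qed.

Lemma lt3_dense e p q : lt3 k e p q ->
  exists z, lt3 k e p (pt z) && lt3 k e (pt z) q.
Proof.
move=> epq; have [z] := btw_ex (lt3_ends epq).
by rewrite (btw_lt3 _ epq); exists z.
Qed.

Lemma linear_unbounded p : ~~ is_circ k ->
  (exists z, pt z < p) /\ (exists z, p < pt z).
Proof.
move=> ck; have [lp np /eqP pT p0] := cutP p; have [_ + _] := HL.
rewrite /ends_ok (negbTE ck) => eL; split.
  apply: contrapT => /forallNP ne.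
  have /p0 [ci _] : val p = set0; last by rewrite ci in ck.
  by apply/seteqP; split=> // z pz; case: (ne z); apply/lt_pt.
have [z pz] : exists z, ~ val p z.
  by apply: contrapT => /forallNP ne; case/eqP: pT; apply/seteqP; split=> // z _; apply: contrapT => /ne.
have [t zt] : exists t, z < t.
  apply: contrapT => /forallNP ne; case: (eL z); right => t.
  by rewrite leNgt; apply/negP => /ne.
exists t; apply: le_lt_trans (_ : pt z < _); first exact/le_pt.
by rewrite pt_lt.
Qed.

Lemma lt3_above e p : off k e p -> exists z, lt3 k e p (pt z).
Proof.
rewrite /off /lt3 => ep; case ck: (is_circ k); last first.
  by case: (linear_unbounded p) => //; rewrite ck.
have : valid_ends k p e by move: ep; rewrite /valid_ends ck.
by case/btw_ex => z; rewrite /btw ck => pze; exists z; move: pze; rewrite /cr orbA orbC.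
Qed.

Lemma lt3_below e p : off k e p -> exists z, lt3 k e (pt z) p.
Proof.
rewrite /off /lt3 => ep; case ck: (is_circ k); last first.
  by case: (linear_unbounded p) => //; rewrite ck.
have : valid_ends k e p by move: ep; rewrite /valid_ends ck eq_sym.
by case/btw_ex => z; rewrite /btw ck; exists z.
Qed.

Lemma btw_nbr p q r : valid_ends k p q -> valid_ends k p r ->
  exists z, btw k p q (pt z) && btw k p r (pt z).
Proof.
move=> pq pr; have [z1 pz1] := btw_ex pq.
have [|] := boolP (btw k p r (pt z1)) => rz1; first by exists z1; rewrite pz1.
have [z2 pz2] := btw_ex pr; exists z2.
by rewrite pz2 (btw_split_l pr pz1 rz1 pz2).
Qed.

Lemma btw_nbl p q r : valid_ends k q p -> valid_ends k r p ->
  exists z, btw k q p (pt z) && btw k r p (pt z).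
Proof.
move=> pq pr; have [z1 pz1] := btw_ex pq.
have [|] := boolP (btw k r p (pt z1)) => rz1; first by exists z1; rewrite pz1.
have [z2 pz2] := btw_ex pr; exists z2.
by rewrite pz2 (btw_split_r pr pz1 rz1 pz2).
Qed.

Lemma lt3_ext e p q : off k e p -> off k e q ->
  (forall z, lt3 k e (pt z) p = lt3 k e (pt z) q) -> p = q.
Proof.
move=> ep eq pq; case: (lt3_total ep eq) => // /lt3_dense [z /andP[z1 z2]].
- by move: z1; rewrite (negbTE (lt3_asym _)) // pq.
- by move: z1; rewrite (negbTE (lt3_asym _)) // -pq.
Qed.

(* Dedekind completeness of the line based at a point of [L]. *)
Lemma cut_exists (e : L) (S : set L) :
  (forall x, S x -> off k e x) ->
  (forall x y, lt3 k e x y -> S y -> S x) ->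
  (forall x, S x -> exists2 y, S y & lt3 k e x y) ->
  (exists x, S x) -> (exists2 x, off k e x & ~ S x) ->
  exists c, off k (pt e) c /\ forall z, lt3 k (pt e) (pt z) c <-> S z.
Proof.
have [dL eL _] := HL.
move=> Soff Slow Smax [s Ss] [u eu nSu].
have mk A : is_cut k A -> exists c : X, val c = A.
  by move=> Acut; exists (of_cut Acut).
case ck: (is_circ k); last first.
  have [|c cE] := mk S.
    split=> [x y xy|x /Smax [y Sy]||S0].
    - by apply: Slow; rewrite /lt3 ck.
    - by rewrite /lt3 ck; exists y.
    - by move=> ST; apply: nSu; rewrite ST.
    - by move: Ss; rewrite S0.
  exists c; rewrite /off /lt3 ck; split=> // z; rewrite -cE; exact: lt_pt.
rewrite /lt3 /off ck /= in Soff Slow Smax eu *.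
(* The line based at [e] runs upwards from [e], passes infinity and comes back from the bottom to
   [e]. If [S] reaches the second stretch, its supremum lies below [e] and is the cut of the points
   of [S] below [e]. *)
have [[t St te]|ne] := pselect (exists2 t, S t & t < e).
  have [|c cE] := mk [set z | z < e /\ S z].
    split=> [x y xy [ye Sy]|x [xe Sx]||A0].
    - split; first exact: lt_trans xy ye.
      by apply: Slow Sy; rewrite /cr xy ye !orbT.
    - by have [y Sy /(cr_below xe) [ye xy]] := Smax _ Sx; exists y.
    - by move=> /seteqP [_ /(_ e I)] [] /=; rewrite ltxx.
    - by have : [set z | z < e /\ S z] t by []; rewrite A0.
  have ce : c < pt e.
    apply/cut_ltP; exists u; last by rewrite cE => -[].
    rewrite /= lt_neqAle eu leNgt; apply/negP => eu'.
    by apply: nSu; apply: Slow St; rewrite /cr te eu' !orbT.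
  exists c; split; first by rewrite lt_eqF.
  have zc z : (pt z < c) <-> z < e /\ S z by rewrite lt_pt cE.
  have Se z : e < z -> S z.
    by move=> ez; apply: Slow St; rewrite /cr te ez !orbT.
  move=> z; rewrite /cr pt_lt ce andbT /=; split=> [/or3P[/andP[/Se]|/zc[]|/Se]|Sz] //.
  have := Soff _ Sz; case: (ltgtP z e) => //= ze _; last by rewrite !orbT.
  by apply/orP; left; apply/zc.
have Sgt x : S x -> e < x.
  move=> Sx; rewrite lt_neqAle eq_sym Soff //= leNgt.
  by apply/negP => xe; apply: ne; exists x.
have Sle x y : e < x -> x < y -> S y -> S x.
  by move=> ex xy; apply: Slow; rewrite /cr ex xy.
have Sm x : S x -> exists2 y, S y & x < y.
  move=> Sx; have [y Sy exy] := Smax _ Sx; exists y => //.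
  exact: cr_above (Sgt _ Sx) (Sgt _ Sy) exy.
pose A := [set z | z <= e \/ S z].
(* Now [S] lies above [e]. If it contains everything above [e], its supremum is the point at
   infinity, that is the empty cut; [L] then has no maximum because [S] has none. *)
have [AT|AT] := pselect (A = setT).
  have zA z : A z by rewrite AT.
  have [|c c0] := mk set0.
    split=> // [/seteqP [_ /(_ e I)]//|_].
    split=> // -[m mmax]; have [/le_lt_trans/(_ (Sgt _ Ss))|/Sm [y _]] := zA m.
      by rewrite ltNge mmax.
    by rewrite ltNge mmax.
  have ue : u < e by case: (zA u) => //; rewrite le_eqVlt (negbTE eu).
  have ce : c < pt e by apply/cut_ltP; exists u => //; rewrite c0.
  have zc z : pt z < c = false by apply/negP => /lt_pt; rewrite c0.
  exists c; split=> [|z]; first by rewrite lt_eqF.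
  rewrite /cr !zc pt_lt ce andbF /=; split=> [ez|/Sgt//].
  by case: (zA z) => //; rewrite leNgt ez.
have [|c cE] := mk A.
  split=> //.
  - move=> x y xy [ye|Sy]; first by left; rewrite ltW // (lt_le_trans xy).
    by case: (leP x e) => [|ex]; [left|right; apply: Sle xy Sy].
  - move=> x [xe|/Sm [y Sy xy]]; last by exists y => //; right.
    by exists s; [right|apply: le_lt_trans xe (Sgt _ Ss)].
  - by move=> A0; have : A s by [right]; rewrite A0.
have ec : pt e < c by apply/lt_pt; rewrite cE; left.
have zc z : (pt z < c) <-> A z by rewrite lt_pt cE.
exists c; split=> [|z]; first by rewrite gt_eqF.
rewrite /cr (lt_gtF ec) pt_lt andbF !orbF; split=> [/andP[ez /zc[]//]|Sz].
  by rewrite leNgt ez.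
by rewrite Sgt //=; apply/zc; right.
Qed.
End Completion.

(** * Extending automorphisms to the completion *)

Definition reversible (k : kind) : bool :=
  match k with Monotonic | Monocircular => true | _ => false end.

Section Orientation.
Context {d : Order.disp_t} {T : orderType d} (k : kind).
Implicit Types (x y z e c : T) (f g : T -> T) (b : bool).

Definition lt3b b e x y := if b then lt3 k e x y else lt3 k e y x.

Definition ori b g := forall e x y, lt3 k (g e) (g x) (g y) = lt3b b e x y.

Lemma cr_rot x y z : cr x y z = cr y z x.
Proof. by rewrite /cr orbA orbC orbA orbC orbA. Qed.

(** From here on the four kinds differ only through [is_circ] and, for the orientations allowed,
    through [reversible]. *)
Lemma nearly_autoP g :
  nearly_auto k g <-> bijective g /\ exists2 b, ori b g & b || reversible k.
Proof.
rewrite /nearly_auto /ori /lt3b /lt3; split.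
- case: k => /= -[bg og]; split=> //.
  + by exists true => // _; exact: og.
  + by case: og => og; [exists true => // _|exists false => // _ x y]; exact: og.
  + by exists true.
  + case: og => og; [by exists true|exists false => // e x y].
    by rewrite og [RHS]cr_rot.
- case: k => /= -[bg [[] // og _]]; split=> //.
  + by move=> x y; exact: (og x x y).
  + by left=> x y; exact: (og x x y).
  + by right=> x y; exact: (og x y x).
  + by left.
  + by right=> x y z; rewrite og cr_rot.
Qed.

Lemma lt3b_trans b e y x z : lt3b b e x y -> lt3b b e y z -> lt3b b e x z.
Proof. by case: b => /= [|yx zy]; [exact: lt3_trans|exact: lt3_trans zy yx]. Qed.

Lemma lt3b_asym b e x y : lt3b b e x y -> ~~ lt3b b e y x.
Proof. by case: b; exact: lt3_asym. Qed.

Lemma lt3b_off b e x y : lt3b b e x y -> off k e x /\ off k e y.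
Proof. by case: b => xy; rewrite (lt3_offl xy) (lt3_offr xy). Qed.

Lemma lt3b_total b e x y : off k e x -> off k e y ->
  [\/ lt3b b e x y, x = y | lt3b b e y x].
Proof.
by case: b => ex ey; case: (lt3_total ex ey) => xy;
  first [by constructor 1|by constructor 2|by constructor 3].
Qed.

Lemma ori_comp b b' f g : ori b f -> ori b' g -> ori (b == b') (f \o g).
Proof.
by move=> of_ og e x y; rewrite /= of_ /lt3b; case: b of_ => of_; rewrite !og; case: b' og.
Qed.

Lemma ori_inv b f g : cancel g f -> ori b f -> ori b g.
Proof.
by move=> gK of_ e x y; rewrite -{2}[e]gK -{2}[x]gK -{2}[y]gK /lt3b; case: b of_ => of_; rewrite of_.
Qed.

Lemma off_inj g e x : injective g -> off k (g e) (g x) = off k e x.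
Proof. by move=> ig; rewrite /off (inj_eq ig). Qed.

Lemma cr_based e c x y : c != e -> x != e -> y != e -> cr c x y =
  [|| cr e c x && cr e x y, cr e x y && cr e y c | cr e y c && cr e c x].
Proof. ordlia Circular [:: e; c; x; y]. Qed.

(** One base suffices: by [cr_based] the cyclic order of points other than [e] is a Boolean
    combination of comparisons along the line based at [e], and a triple containing [e] is rotated
    until [e] comes first. *)
Lemma ori_based b e g :
  (forall x, off k e x -> off k (g e) (g x)) ->
  (forall x y, off k e x -> off k e y -> lt3 k (g e) (g x) (g y) = lt3b b e x y) ->
  ori b g.
Proof.
rewrite /off /ori /lt3b /lt3; case: (is_circ k) => /= [go gl|_ gl] c x y; last first.
  exact: gl.
have xx0 z t : cr z z t = false by rewrite /cr ltxx; case: ltgtP.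
have xyx z t : cr z t z = false by rewrite cr_rot cr_rot xx0.
have ge z : (g z == g e) = (z == e).
  by apply/idP/idP => [|/eqP-> //]; apply: contraLR => /go.
have [->|ce] := eqVneq c e.
  have [->|xe] := eqVneq x e; first by rewrite xx0; case: b {gl}; rewrite ?xx0 ?xyx.
  have [->|ye] := eqVneq y e; first by rewrite xyx; case: b {gl}; rewrite ?xx0 ?xyx.
  exact: gl.
have [->|xe] := eqVneq x e.
  have [->|ye] := eqVneq y e.
    by rewrite cr_rot xx0; case: b {gl}; rewrite cr_rot xx0.
  by rewrite cr_rot gl //; case: b {gl}; rewrite // cr_rot // cr_rot.
have [->|ye] := eqVneq y e.
  by rewrite cr_rot cr_rot gl //; case: b {gl}; rewrite // cr_rot // cr_rot.
rewrite (@cr_based (g e)) ?ge // !gl //.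
have [E1 E2] := (cr_based ce xe ye, cr_based ce ye xe).
by case: b {gl}; rewrite /= ?E1 // E2; move: (cr e c y) (cr e y x) (cr e x c) => [] [] [].
Qed.
End Orientation.

Section Extension.
Context {k : kind} {d : Order.disp_t} {L : orderType d}.
Local Notation X := (completion k L).
Implicit Types (x y z e : L) (c p q u v w : X) (g h : L -> L) (b : bool).
Hypothesis HL : ample k L.
Local Notation pt := (pt HL).

Lemma off_ex c : exists e, off k (pt e) c.
Proof.
have [_ _ [x [y xy]]] := HL.
have [->|cx] := eqVneq c (pt x); last by exists x; rewrite /off cx implybT.
by exists y; rewrite off_pt /off lt_eqF ?implybT.
Qed.

Lemma lt3_ex e : exists x y, lt3 k e x y.
Proof.
have [x] := off_ex (pt e); rewrite off_pt => ex.
have /lt3_above : off k (pt e) (pt x) by rewrite off_pt /off eq_sym.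
by move=> /(_ HL)[y]; rewrite lt3_pt; exists x, y.
Qed.

Lemma ori_uniq b b' g : ori k b g -> ori k b' g -> b = b'.
Proof.
move=> og og'; have [_ _ [e _]] := HL; have [x [y exy]] := lt3_ex e.
have := og e x y; rewrite og' /lt3b exy (negbTE (lt3_asym exy)).
by case: b b' {og og'} => [] [].
Qed.

Lemma lt3b_dense b c p q : lt3b k b c p q ->
  exists z, lt3b k b c p (pt z) && lt3b k b c (pt z) q.
Proof. by case: b => /(lt3_dense HL) [z]; exists z; rewrite // andbC. Qed.

Lemma lt3b_above b c p : off k c p -> exists z, lt3b k b c p (pt z).
Proof. by case: b; [exact: lt3_above|exact: lt3_below]. Qed.

Lemma lt3b_below b c p : off k c p -> exists z, lt3b k b c (pt z) p.
Proof. by case: b; [exact: lt3_below|exact: lt3_above]. Qed.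

Lemma ori_off b (f : X -> X) e c : ori k b f -> off k (pt e) c ->
  off k (f (pt e)) (f c).
Proof.
case: b => of_ ec.
  have [z cz] := lt3_above HL ec.
  by have := of_ (pt e) c (pt z); rewrite /= cz => /lt3_offl.
have [z cz] := lt3_below HL ec.
by have := of_ (pt e) c (pt z); rewrite /= cz => /lt3_offl.
Qed.

(** A point is determined by the points of [L] that precede it on a line. Along the line based at
    [g e], the same points precede both images of [c], since both maps agree with [g] on [L]. *)
Lemma lift_uniq b g (f1 f2 : X -> X) : bijective g -> ori k b f1 -> ori k b f2 ->
  (forall x, f1 (pt x) = pt (g x)) -> (forall x, f2 (pt x) = pt (g x)) -> f1 = f2.
Proof.
move=> [g' gK g'K] o1 o2 E1 E2; apply/funext => c; have [e ec] := off_ex c.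
have fo f : ori k b f -> (forall x, f (pt x) = pt (g x)) -> off k (pt (g e)) (f c).
  by move=> of_ fE; rewrite -fE; exact: ori_off of_ ec.
apply: (lt3_ext (fo _ o1 E1) (fo _ o2 E2)) => z.
rewrite -(g'K z) -[in LHS]E1 -[in LHS]E1 -[in RHS]E2 -[in RHS]E2.
by rewrite o1 o2.
Qed.

(** A point [c] goes to the supremum, along the line based at [g e], of the images of the points of
    [L] that precede [c], or that follow it when [g] reverses. *)
Lemma lift_exists b g g' : cancel g g' -> cancel g' g -> ori k b g ->
  exists2 f : X -> X, ori k b f & forall x, f (pt x) = pt (g x).
Proof.
move=> gK g'K og; have [_ _ [e _]] := HL.
have og' : ori k b g' := ori_inv g'K og.
have gi := can_inj gK; have g'i := can_inj g'K.
have lt3g x y : lt3 k (pt (g e)) (pt (g x)) (pt (g y)) = lt3b k b (pt e) (pt x) (pt y).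
  by rewrite lt3_pt og /lt3b !lt3_pt.
have offg x : off k (pt (g e)) (pt (g x)) = off k (pt e) (pt x).
  by rewrite !off_pt off_inj.
have /choice [f fP] : forall c, exists c', off k (pt e) c ->
    off k (pt (g e)) c' /\
    forall x, lt3 k (pt (g e)) (pt (g x)) c' = lt3b k b (pt e) (pt x) c.
  move=> c; have [ec|] := boolP (off k (pt e) c); last by exists c.
  pose S z := lt3b k b (pt e) (pt (g' z)) c.
  have [|x y|x|||c' [c'e c'P]] := @cut_exists k d L HL (g e) S.
  - move=> x; rewrite -{2}(g'K x) off_inj // -(off_pt HL).
    by case/lt3b_off.
  - rewrite -{1}(g'K x) -{1}(g'K y) -(lt3_pt HL) lt3g.
    exact: lt3b_trans.
  - move=> /lt3b_dense [z /andP[xz zc]]; exists (g z); first by rewrite /S gK.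
    by rewrite -{1}(g'K x) -(lt3_pt HL) lt3g.
  - by have [z] := lt3b_below b ec; exists (g z); rewrite /S gK.
  - have [z cz] := lt3b_above b ec; exists (g z).
      by rewrite off_inj // -(off_pt HL); case: (lt3b_off cz).
    by rewrite /S gK; apply/negP/lt3b_asym.
  exists c' => _; split=> // x; apply/idP/idP; first by move/c'P; rewrite /S gK.
  by move=> xc; apply/c'P; rewrite /S gK.
(* On the circle the base is not a point of its own line, so its image is prescribed separately. *)
pose F c := if is_circ k && (c == pt e) then pt (g e) else f c.
have Fe : F (pt e) = pt (g e).
  rewrite /F eqxx andbT; case ck: (is_circ k) => //.
  have offT p q : off k p q by rewrite /off ck.
  have [_ fe] := fP _ (offT (pt e) (pt e)).
  apply: (@lt3_ext _ _ _ HL _ _ _ (offT (pt (g e)) _) (offT _ _)) => z.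
  by rewrite -(g'K z) fe lt3g.
have Ff c : off k (pt e) c -> F c = f c.
  by rewrite /F /off; case: (is_circ k) => //= /negbTE ->.
have FE x : F (pt x) = pt (g x).
  have [ex|] := boolP (off k (pt e) (pt x)); last first.
    by rewrite negb_imply negbK pt_eq => /andP[_ /eqP->].
  rewrite Ff //; have [fx fxP] := fP _ ex.
  apply: (@lt3_ext _ _ _ HL _ _ _ fx); first by rewrite offg.
  by move=> z; rewrite -(g'K z) fxP lt3g.
exists F => //; apply: (@ori_based _ _ _ b (pt e)) => [c ec|p q ep eq].
  by rewrite Fe Ff //; have [] := fP _ ec.
(* Strict monotonicity in one direction is enough; totality gives the converse. *)
have mono p' q' : off k (pt e) p' -> off k (pt e) q' -> lt3b k b (pt e) p' q' ->
    lt3 k (pt (g e)) (f p') (f q').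
  move=> ep' eq' pq.
  have [z /andP[pz zq]] := lt3b_dense pq.
  have [fp fpP] := fP _ ep'; have [fq fqP] := fP _ eq'.
  have gz : lt3 k (pt (g e)) (pt (g z)) (f q') by rewrite fqP.
  have : ~~ lt3 k (pt (g e)) (pt (g z)) (f p').
    by rewrite fpP lt3b_asym.
  case: (lt3_total fp (lt3_offl gz)) => [pgz _|-> //|-> //].
  exact: lt3_trans pgz gz.
rewrite Fe !Ff //; apply/idP/idP => [fpq|]; last exact: mono.
case: (lt3b_total b ep eq) => // [E|/(mono _ _ eq ep)/lt3_asym].
  by move: fpq; rewrite E lt3_irr.
by rewrite fpq.
Qed.
End Extension.

Section ExtensionMorphism.
Context {k : kind} {d : Order.disp_t} {L : orderType d}.
Local Notation X := (completion k L).
Implicit Types (x y z e : L) (c p q u v w : X) (g h : L -> L) (b : bool).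
Hypothesis HL : ample k L.
Local Notation pt := (pt HL).

Lemma nearly_auto_comp g h :
  nearly_auto k g -> nearly_auto k h -> nearly_auto k (g \o h).
Proof.
move=> /nearly_autoP [bg [b og rb]] /nearly_autoP [bh [b' oh rb']].
apply/nearly_autoP; split; first exact: bij_comp.
exists (b == b'); first exact: ori_comp.
by case: b b' rb rb' {og oh} => [] [].
Qed.

Lemma nearly_auto_inv g h :
  cancel g h -> cancel h g -> nearly_auto k g -> nearly_auto k h.
Proof.
move=> gK hK /nearly_autoP [bg [b og rb]]; apply/nearly_autoP; split.
  by exists g.
by exists b => //; exact: ori_inv og.
Qed.

(** [ext] is a choice among extensions, so one has to exist. The lifts of [g] and of its inverse
    compose to lifts of the identity, which [lift_uniq] identifies with the identity; this makes the
    lift bijective. *)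
Lemma ext_spec g : nearly_auto k g ->
  nearly_auto k (@ext k _ L g) /\ forall x, ext g (pt x) = pt (g x).
Proof.
move=> /nearly_autoP [[g' gK g'K] [b og rb]].
pose P := [set gb : X -> X | nearly_auto k gb /\
  forall c x, is_point c x -> is_point (gb c) (g x)].
suff : P (ext g).
  by case=> ng E; split=> // x; apply/pt_point/E/pt_point.
apply: xgetPex.
have og' : ori k b g' := ori_inv g'K og.
have [f of_ fE] := lift_exists HL gK g'K og.
have [f' of' f'E] := lift_exists HL g'K gK og'.
have bb : (b == b) = true by rewrite eqxx.
have fK : f' \o f = id.
  apply: (@lift_uniq _ _ _ HL true id) => [||//|x|//]; first by exists id.
    by rewrite -bb; exact: ori_comp.
  by rewrite /= fE f'E gK.
have f'K : f \o f' = id.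
  apply: (@lift_uniq _ _ _ HL true id) => [||//|x|//]; first by exists id.
    by rewrite -bb; exact: ori_comp.
  by rewrite /= f'E fE g'K.
exists f; split.
  apply/nearly_autoP; split; last by exists b.
  by exists f' => c; [rewrite -[LHS]/((f' \o f) c) fK|rewrite -[LHS]/((f \o f') c) f'K].
by move=> c x /(pt_point HL) ->; apply/(pt_point HL)/fE.
Qed.

Lemma ext_pt g x : nearly_auto k g -> ext g (pt x) = pt (g x).
Proof. by case/ext_spec. Qed.

Lemma ext_ori b g : nearly_auto k g -> ori k b g -> ori k b (@ext k _ L g).
Proof.
move=> ng og; have [/nearly_autoP [_ [b' og' _]] E] := ext_spec ng.
suff -> : b = b' by [].
apply: (ori_uniq HL og) => e x y.
by rewrite -(lt3_pt HL) -!E og' /lt3b !lt3_pt.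
Qed.

Lemma ext_uniq b g (f : X -> X) : nearly_auto k g -> ori k b f ->
  (forall x, f (pt x) = pt (g x)) -> ext g = f.
Proof.
move=> ng of_ fE; have [/nearly_autoP [[g' gK g'K] _] E] := ext_spec ng.
have [bg _] := (nearly_autoP k g).1 ng.
apply: (lift_uniq bg _ of_ E fE); apply: ext_ori => // e x y.
by rewrite -(lt3_pt HL) -!fE of_ /lt3b !lt3_pt.
Qed.

Lemma nearly_auto_id : nearly_auto k (@id L).
Proof. by apply/nearly_autoP; split; [exists id|exists true]. Qed.

Lemma ext_id : @ext k _ L id = id.
Proof. by apply: (@ext_uniq true) => //; exact: nearly_auto_id. Qed.

Lemma ext_comp g h : nearly_auto k g -> nearly_auto k h ->
  @ext k _ L (g \o h) = ext g \o ext h.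
Proof.
move=> ng nh; have ngh := nearly_auto_comp ng nh.
have [_ [b og _]] := (nearly_autoP k g).1 ng.
have [_ [b' oh _]] := (nearly_autoP k h).1 nh.
apply: (ext_uniq ngh (ori_comp (ext_ori ng og) (ext_ori nh oh))) => x.
by rewrite /= !ext_pt.
Qed.

Lemma ext_can g h : nearly_auto k g -> cancel g h -> cancel h g ->
  cancel (@ext k _ L g) (ext h).
Proof.
move=> ng gK hK c; have nh := nearly_auto_inv gK hK ng.
rewrite -[LHS]/((ext h \o ext g) c) -ext_comp //.
by rewrite (_ : h \o g = id) ?ext_id //; apply/funext/gK.
Qed.

Lemma neq_id_ex g : g <> id -> exists x, g x <> x.
Proof.
move=> gid; apply: contrapT => /forallNP ne; apply: gid; apply/funext => x.
exact: contrapT (ne x).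
Qed.

End ExtensionMorphism.

(** * Intervals *)

Section OriBtw.
Context {d : Order.disp_t} {T : orderType d} (k : kind).
Implicit Types (f g : T -> T) (p q z t u v : T).

Lemma btw_ori f p q z : ori k true f -> btw k (f p) (f q) (f z) = btw k p q z.
Proof.
move=> of_; have := of_ p z q; have := of_ p p z; rewrite /btw /lt3b /lt3.
by case: (is_circ k) => // -> ->.
Qed.

Lemma btw_anti f p q z : ori k false f -> btw k (f q) (f p) (f z) = btw k p q z.
Proof.
move=> of_; have := of_ q z p; have := of_ p q z; rewrite /btw /lt3b /lt3.
case: (is_circ k) => [_ ->|-> ->]; last by rewrite andbC.
by rewrite cr_rot.
Qed.

Lemma ends_ori f p q : injective f -> ori k true f ->
  valid_ends k (f p) (f q) = valid_ends k p q.
Proof.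
move=> fi /(_ p p q); rewrite /valid_ends /lt3b /lt3.
by case: (is_circ k) => // _; rewrite (inj_eq fi).
Qed.

Lemma btw_ends_r p q z : btw k p q z -> valid_ends k p z.
Proof. ordlia k [:: p; q; z]. Qed.

Lemma btw_ends_l p q z : btw k p q z -> valid_ends k z q.
Proof. ordlia k [:: p; q; z]. Qed.

Lemma btw_widenl p q z t : btw k p q z -> btw k p z t -> btw k p q t.
Proof. ordlia k [:: p; q; z; t]. Qed.

Lemma btw_widenr p q z t : btw k p q z -> btw k z q t -> btw k p q t.
Proof. ordlia k [:: p; q; z; t]. Qed.

Lemma not_btw_side p q z u v : valid_ends k p q -> ~~ btw k p q z -> btw k u v z ->
  (exists l, valid_ends k l z /\ forall t, btw k l z t -> ~~ btw k p q t) \/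
  (exists r, valid_ends k z r /\ forall t, btw k z r t -> ~~ btw k p q t).
Proof.
move=> pq npqz uvz; have [zp|] := boolP ((is_circ k && (z == p)) || ~~ is_circ k && ~~ (p < z)).
  left; exists (if is_circ k then q else u); split=> [|t].
    by move: pq uvz zp; ordlia k [:: p; q; z; u; v].
  by move: zp; ordlia k [:: p; q; z; u; t].
move=> zp; right; exists (if is_circ k then p else v); split=> [|t].
  by move: uvz zp; ordlia k [:: p; z; u; v].
by move: npqz zp; ordlia k [:: p; q; z; v; t].
Qed.
End OriBtw.

Section Intervals.
Context {k : kind} {d : Order.disp_t} {L : orderType d}.
Local Notation X := (completion k L).
Implicit Types (x y z e : L) (c p q u v w : X) (I J K : set L).
Hypothesis HL : ample k L.
Local Notation pt := (pt HL).

Lemma inbar_pt I z : inbar k I (pt z) <-> I z.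
Proof.
split=> [[x Ix /(pt_point HL)/eqP]|Iz]; last by exists z => //; apply/pt_point.
by rewrite pt_eq => /eqP ->.
Qed.

Lemma trace_eq I (Ib : set X) :
  inbar k I = Ib `&` inbar k setT <-> forall z, I z <-> Ib (pt z).
Proof.
split=> [E z|E].
  by rewrite -inbar_pt E; split=> [[]|Iz] //; split=> //; apply/inbar_pt.
apply/seteqP; split=> c.
  by case=> x Ix /(pt_point HL) ->; split; [apply/E|apply/inbar_pt].
by case=> Ic [x _ /(pt_point HL) cx]; rewrite cx in Ic *; apply/inbar_pt/E.
Qed.

Lemma btw_around c : exists u v, btw k u v c.
Proof.
have [e ec] := off_ex HL c.
have [[v cv] [u uc]] := (lt3_above HL ec, lt3_below HL ec).
exists (pt u), (pt v); have uv := lt3_trans uc cv.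
by rewrite (btw_lt3 _ uv) uc.
Qed.

(** Intervals are open, and a point outside one has only points outside it on at least one side
    nearby; so membership can be tested on points of [L]. Intervals are thus determined by their
    traces on [L], which makes [bar] meaningful. *)
Lemma intervalP (Ib : set X) c : is_interval k Ib -> Ib c <->
  exists u v, btw k u v c /\ forall z, btw k u v (pt z) -> Ib (pt z).
Proof.
case=> [[p [q [/endsE pq ->]]]|->|[ck [p [|] ->]]].
- split=> [pqc|[u [v [uvc uvI]]]].
    by exists p, q; rewrite -oitvE; split=> // z; rewrite oitvE.
  apply: contrapT; rewrite oitvE => /negP npqc.
  have [[l [lc E]]|[r [cr_ E]]] := not_btw_side pq npqc uvc.
  - have [z /andP[z1 z2]] := btw_nbl HL lc (btw_ends_r uvc).
    have := uvI z (btw_widenl uvc z2); rewrite oitvE => z3.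
    by have := E (pt z) z1; rewrite z3.
  - have [z /andP[z1 z2]] := btw_nbr HL cr_ (btw_ends_l uvc).
    have := uvI z (btw_widenr uvc z2); rewrite oitvE => z3.
    by have := E (pt z) z1; rewrite z3.
- by split=> // _; have [u [v uvc]] := btw_around c; exists u, v.
- rewrite /=; split=> [cp|[u [v [uvc uvI]]]].
    have [[u uc] _] := linear_unbounded HL c ck.
    exists (pt u), p; rewrite /btw (negbTE ck) uc cp; split=> // z.
    by case/andP.
  have [z /andP[_ z2]] := btw_nbr HL (btw_ends_l uvc) (btw_ends_l uvc).
  have := uvI z (btw_widenr uvc z2); apply: lt_trans.
  by move: z2; rewrite /btw (negbTE ck) => /andP[].
- rewrite /=; split=> [cp|[u [v [uvc uvI]]]].
    have [_ [v cv]] := linear_unbounded HL c ck.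
    exists p, (pt v); rewrite /btw (negbTE ck) cv cp; split=> // z.
    by case/andP.
  have [z /andP[_ z2]] := btw_nbl HL (btw_ends_r uvc) (btw_ends_r uvc).
  have /lt_trans := uvI z (btw_widenl uvc z2); apply.
  by move: z2; rewrite /btw (negbTE ck) => /andP[].
Qed.

Lemma interval_trace_inj (I1 I2 : set X) : is_interval k I1 -> is_interval k I2 ->
  (forall z, I1 (pt z) <-> I2 (pt z)) -> I1 = I2.
Proof.
move=> iI1 iI2 E; apply/seteqP; split=> c /intervalP H.
  by have [u [v [uvc uvI]]] := H iI1; apply/intervalP => //; exists u, v; split=> // z /uvI/E.
by have [u [v [uvc uvI]]] := H iI2; apply/intervalP => //; exists u, v; split=> // z /uvI/E.
Qed.

Lemma bar_endpoints K p q : endpoints_of k K p q ->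
  [/\ valid_ends k p q, bar k K = oitv k p q & forall z, K z <-> btw k p q (pt z)].
Proof.
case=> pq /[dup] KE /trace_eq tK; split; first exact/endsE.
  have ipq : is_interval k (oitv k p q) by constructor 1; exists p, q.
  pose P := [set Ib : set X | is_interval k Ib /\ inbar k K = Ib `&` inbar k setT].
  have [ib /trace_eq tb] : P (bar k K) by apply: xgetPex; exists (oitv k p q).
  by apply: interval_trace_inj => // z; rewrite -tb tK.
by move=> z; rewrite tK oitvE.
Qed.
End Intervals.

(** * Approximate transitivity on points of the completion *)

Section Sequences.

Lemma pairwise_tnth (T : Type) (r : rel T) (s : seq T) : pairwise r s ->
  forall i j : 'I_(size s), (i < j)%N -> r (tnth (in_tuple s) i) (tnth (in_tuple s) j).
Proof.
move=> rs i j ij; have x0 := tnth (in_tuple s) i; rewrite !(tnth_nth x0).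
by apply: (pairwiseP x0 rs) => //; rewrite inE.
Qed.

Lemma pairwise_flatten (T : Type) (r : rel T) (ss : seq (seq T)) :
  all (pairwise r) ss -> pairwise (allrel r) ss -> pairwise r (flatten ss).
Proof.
elim: ss => //= s ss IH /andP[rs rss] /andP[sss rsss].
rewrite pairwise_cat rs IH // !andbT.
by elim: ss sss {IH rss rsss} => [|t ss IH] /=; rewrite ?allrel0r // allrel_catr => /andP[-> /IH].
Qed.

Lemma pairwise_iota (r : rel nat) n :
  (forall i j, (i < j < n)%N -> r i j) -> pairwise r (iota 0 n).
Proof.
move=> rP; apply/(pairwiseP 0%N) => i j; rewrite !inE size_iota => i_n j_n ij.
by rewrite !nth_iota //; apply: rP; rewrite ij.
Qed.

Lemma block_lt m a b i j : (a < m)%N -> (i < j)%N -> (m * i + a < m * j + b)%N.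
Proof. nia. Qed.
End Sequences.

Section PointLemmas.
Context {d : Order.disp_t} {T : orderType d} (k : kind).
Implicit Types (e x y z u v p q : T).

Lemma cr_chain e x y z : cr e x y -> cr e y z -> cr x y z.
Proof. ordlia Circular [:: e; x; y; z]. Qed.

Lemma lt3_cases e x u v y : lt3 k e x v -> lt3 k e u y -> ~~ lt3 k e u v ->
  lt3 k e x y.
Proof. ordlia k [:: e; x; u; v; y]. Qed.
End PointLemmas.

Section Transitivity.
Context {k : kind} {d : Order.disp_t} {L : orderType d}.
Local Notation X := (completion k L).
Implicit Types (x y z : L) (c e p q u v w : X) (G H : set (L -> L)).
Hypothesis HL : ample k L.
Local Notation pt := (pt HL).

Lemma near_list b e (l : seq X) p : off k e p ->
  exists w, lt3b k b e p w && all (fun x : X => lt3b k b e p x ==> lt3b k b e w x) l.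
Proof.
move=> ep; elim: l => [|q l [w /andP[pw wl]]].
  by have [w pw] := lt3b_above HL b ep; exists (pt w); rewrite pw.
have [pq|pq] := boolP (lt3b k b e p q); last first.
  by exists w; rewrite pw /= wl (negbTE pq).
have [wq|wq] := boolP (lt3b k b e w q).
  by exists w; rewrite pw /= wl pq wq.
have [z /andP[pz zq]] := lt3b_dense HL pq; exists (pt z); rewrite pz /= zq implybT /=.
apply: sub_all wl => x /implyP wx; apply/implyP => /wx wx'.
have [_ eq] := lt3b_off pq; have [_ ew] := lt3b_off pw.
apply: lt3b_trans zq _; case: (lt3b_total b ew eq) => [|<- //|]; first by rewrite (negbTE wq).
by move/lt3b_trans; apply.
Qed.

Lemma sandwich e (l : seq X) : exists lo hi : X -> X,
  (forall p, p \in l -> off k e p -> lt3 k e (lo p) p && lt3 k e p (hi p)) /\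
  (forall p q, p \in l -> q \in l -> lt3 k e p q -> lt3 k e (hi p) (lo q)).
Proof.
have /choice [hi hiP] : forall p, exists w, off k e p ->
    lt3b k true e p w && all (fun x : X => lt3b k true e p x ==> lt3b k true e w x) l.
  move=> p; have [ep|] := boolP (off k e p); last by exists p.
  by have [w] := near_list true l ep; exists w.
(* [lo] is chosen after [hi]: it lies to the right of every value of [hi] that precedes [p], in
   particular of those at the points of [l] before [p], so that the neighbourhoods are disjoint. *)
have /choice [lo loP] : forall p, exists w, off k e p -> lt3b k false e p w &&
    all (fun x : X => lt3b k false e p x ==> lt3b k false e w x) (map hi l).
  move=> p; have [ep|] := boolP (off k e p); last by exists p.
  by have [w] := near_list false (map hi l) ep; exists w.
exists lo, hi; split=> [p pl ep|p q pl ql pq].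
  by have /andP[h _] := hiP _ ep; have /andP[l' _] := loP _ ep; apply/andP.
have /andP[_ /allP/(_ _ ql)/implyP/(_ pq) hq] := hiP _ (lt3_offl pq).
have /andP[_ /allP/(_ _ (map_f hi pl))/implyP] := loP _ (lt3_offr pq).
exact.
Qed.

Lemma line_chain e p q : lt3 k e p q -> exists y : nat -> X,
  (forall i, lt3 k e p (y i) && lt3 k e (y i) q) /\
  forall i j, (i < j)%N -> lt3 k e (y i) (y j).
Proof.
move=> pq; have /choice [F FP] : forall z : X, exists w, lt3 k e z q ->
    lt3 k e z w && lt3 k e w q.
  move=> z; have [zq|] := boolP (lt3 k e z q); last by exists z.
  by have [w] := lt3_dense HL zq; exists (pt w).
have yq i : lt3 k e (iter i F p) q by elim: i => //= i /FP/andP[].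
have yS i : lt3 k e (iter i F p) (iter i.+1 F p) by have /FP/andP[] := yq i.
have ylt i j : (i < j)%N -> lt3 k e (iter i F p) (iter j F p).
  elim: j => // j IH; rewrite ltnS leq_eqVlt => /predU1P [->|/IH ij]; first exact: yS.
  exact: lt3_trans ij (yS j).
exists (fun i => iter i.+1 F p); split=> [i|i j ij]; last exact: ylt.
by rewrite (ylt 0%N) // yq.
Qed.

Lemma line_ordered_sets n (J : n.-tuple (set L)) e :
  (forall i, tnth J i !=set0) ->
  (forall i j : 'I_n, (i < j)%N -> forall x y, tnth J i x -> tnth J j y ->
     lt3 k e (pt x) (pt y)) ->
  ordered_sets k J.
Proof.
rewrite /ordered_sets /lt3; case: (is_circ k) => [J0 Jlt|_ Jlt]; last first.
  by move=> i j ij x y Jx Jy; rewrite -(pt_lt HL); exact: Jlt ij x y Jx Jy.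
split=> // x Jx; split=> [i j ij xij|i j l ij jl].
  have := Jlt _ _ ij _ _ (Jx i) (Jx j).
  by rewrite xij /cr ltxx; case: ltgtP; rewrite ?andbF.
rewrite -(cr_pt HL).
exact: cr_chain (Jlt _ _ ij _ _ (Jx i) (Jx j)) (Jlt _ _ jl _ _ (Jx j) (Jx l)).
Qed.

Lemma line_Ninterval e p q : lt3 k e p q -> Ninterval k [set x | btw k p q (pt x)].
Proof.
move=> /lt3_ends/endsE pq; exists (oitv k p q); first by constructor 1; exists p, q.
by apply/(trace_eq HL) => z; rewrite oitvE.
Qed.

(** In an entry [(((u, v), p), q)] some point between [u] and [v] is to be sent between [p] and [q].
    The order of the entries is imposed in negated form so that consecutive intervals may share an
    end, as the intervals on the two sides of a point do. *)
Lemma interval_trans_line G : highly_interval_transitive k G ->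
  forall e c (s : seq (X * X * X * X)),
  all (fun t => lt3 k e t.1.1.1 t.1.1.2 && lt3 k c t.1.2 t.2) s ->
  pairwise (fun t t' => ~~ lt3 k e t'.1.1.1 t.1.1.2 && ~~ lt3 k c t'.1.2 t.2) s ->
  exists2 g, G g & forall t, t \in s -> exists x,
    [&& lt3 k e t.1.1.1 (pt x), lt3 k e (pt x) t.1.1.2,
        lt3 k c t.1.2 (pt (g x)) & lt3 k c (pt (g x)) t.2].
Proof.
move=> hG e c s /allP sv sp; pose t i := tnth (in_tuple s) i.
have ts i : t i \in s by exact: mem_tnth.
have sv1 i : lt3 k e (t i).1.1.1 (t i).1.1.2 by have /andP[] := sv _ (ts i).
have sv2 i : lt3 k c (t i).1.2 (t i).2 by have /andP[] := sv _ (ts i).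
pose I := [tuple [set x | btw k (t i).1.1.1 (t i).1.1.2 (pt x)] | i < size s].
pose J := [tuple [set x | btw k (t i).1.2 (t i).2 (pt x)] | i < size s].
have [i|i|||g Gg gP] := hG _ I J.
- by rewrite tnth_mktuple; exact: line_Ninterval (sv1 i).
- by rewrite tnth_mktuple; exact: line_Ninterval (sv2 i).
- apply: (@line_ordered_sets _ _ e) => [i|i j ij x y].
    by rewrite tnth_mktuple; have [z] := btw_ex HL (lt3_ends (sv1 i)); exists z.
  rewrite !tnth_mktuple /= (btw_lt3 _ (sv1 i)) (btw_lt3 _ (sv1 j)).
  have /andP[+ _] := pairwise_tnth sp ij.
  by move=> nuv /andP[_ xv] /andP[uy _]; exact: lt3_cases xv uy nuv.
- apply: (@line_ordered_sets _ _ c) => [i|i j ij x y].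
    by rewrite tnth_mktuple; have [z] := btw_ex HL (lt3_ends (sv2 i)); exists z.
  rewrite !tnth_mktuple /= (btw_lt3 _ (sv2 i)) (btw_lt3 _ (sv2 j)).
  have /andP[_] := pairwise_tnth sp ij.
  by move=> nuv /andP[_ xv] /andP[uy _]; exact: lt3_cases xv uy nuv.
exists g => // t0 ts0; have /tnthP [i ->] : t0 \in in_tuple s by [].
have [_ [[x + <-]]] := gP i.
rewrite !tnth_mktuple /= (btw_lt3 _ (sv1 i)) (btw_lt3 _ (sv2 i)).
by move=> /andP[x1 x2] /andP[x3 x4]; exists x; apply/and4P.
Qed.

(* In an entry [((a, p), q)], the point [a] is to be sent between [p] and [q]. *)
Definition point_transitive m G := forall e c (s : seq (X * X * X)), (m <= size s)%N ->
  all (fun t => off k e t.1.1 && lt3 k c t.1.2 t.2) s ->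
  pairwise (fun t t' => lt3 k e t.1.1 t'.1.1 && lt3 k c t.2 t'.1.2) s ->
  exists g, [/\ G g, ori k true g & forall t, t \in s ->
    lt3 k c t.1.2 (ext g t.1.1) && lt3 k c (ext g t.1.1) t.2].

Lemma ori_of_chain e c g x y z : nearly_auto k g ->
  lt3 k e (pt x) (pt y) -> lt3 k e (pt y) (pt z) ->
  lt3 k c (pt (g x)) (pt (g y)) -> lt3 k c (pt (g y)) (pt (g z)) -> ori k true g.
Proof.
move=> /nearly_autoP [_ [[] // og _]] xy yz gxy gyz; exfalso.
have := og x y z; move: xy yz gxy gyz; rewrite /lt3b /lt3.
case: (is_circ k) => xy yz gxy gyz; last by move: gyz (lt_gtF yz); rewrite !pt_lt => -> ->.
have := cr_chain xy yz; have := cr_chain gxy gyz; rewrite !cr_pt => -> h1 h2.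
by move: h2; rewrite /cr; move: h1; rewrite /cr; case: (ltgtP x y); case: (ltgtP y z); case: (ltgtP x z).
Qed.

(** Each [a] gets two adjacent intervals, from [lo a] to [a] and from [a] to [hi a], whose targets
    are the two parts into which [M] divides the target of [a]. The images of a point on each side
    enclose the image of [a] if orientation is preserved, and two entries supply the three ordered
    points that force this. *)
Lemma interval_point_transitive G : (forall g, G g -> nearly_auto k g) ->
  highly_interval_transitive k G -> point_transitive 2 G.
Proof.
move=> nG hG e c s s2 /allP sv sp.
have [lo [hi [lohi hilo]]] := sandwich e [seq t.1.1 | t <- s].
have /choice [M MP] : forall t : X * X * X, exists m, lt3 k c t.1.2 t.2 ->
    lt3 k c t.1.2 m && lt3 k c m t.2.
  move=> t; have [pq|] := boolP (lt3 k c t.1.2 t.2); last by exists t.2.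
  by have [m] := lt3_dense HL pq; exists (pt m).
pose A (t : X * X * X) := (lo t.1.1, t.1.1, t.1.2, M t).
pose B (t : X * X * X) := (t.1.1, hi t.1.1, M t, t.2).
have lh t : t \in s -> lt3 k e (lo t.1.1) t.1.1 && lt3 k e t.1.1 (hi t.1.1).
  move=> ts; apply: lohi; first exact: map_f.
  by have /andP[] := sv _ ts.
have Mt t : t \in s -> lt3 k c t.1.2 (M t) && lt3 k c (M t) t.2.
  by move=> ts; apply: MP; have /andP[] := sv _ ts.
have ord t t' : t \in s -> t' \in s -> lt3 k e t.1.1 t'.1.1 && lt3 k c t.2 t'.1.2 ->
    lt3 k e (hi t.1.1) (lo t'.1.1) && lt3 k c t.2 t'.1.2.
  by move=> ts t's /andP[tt' ->]; rewrite andbT; apply: hilo => //; exact: map_f.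
have [||g Gg gP] := @interval_trans_line _ hG e c (flatten [seq [:: A t; B t] | t <- s]).
- apply/allP => x /flattenP [_ /mapP [t ts ->]]; have /andP[l1 l2] := lh _ ts.
  by have /andP[l3 l4] := Mt _ ts; rewrite !inE => /orP[] /eqP -> /=; rewrite ?l1 ?l2 ?l3 ?l4.
- apply: pairwise_flatten; rewrite ?all_map ?pairwise_map.
    by apply/allP => t _ /=; rewrite !lt3_irr.
  apply: (sub_in_pairwise (P := mem s)) sp; last exact/allP.
  move=> t t' ts t's /(ord _ _ ts t's) /andP[h1 h2].
  have /andP[l1 l2] := lh _ ts; have /andP[l3 l4] := Mt _ ts.
  have /andP[l1' l2'] := lh _ t's; have /andP[l3' l4'] := Mt _ t's.
  have [h3 h4] := (lt3_trans h1 l1', lt3_trans l2 h1).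
  have [h5 h6] := (lt3_trans h2 l3', lt3_trans l4 h2).
  have [h7 h8] := (lt3_trans l2 h3, lt3_trans l4 h5).
  by apply/allrelP => x y; rewrite !inE => /orP[] /eqP -> /orP[] /eqP -> /=; rewrite !lt3_asym.
have gA t : t \in s -> exists x, [&& lt3 k e (lo t.1.1) (pt x), lt3 k e (pt x) t.1.1,
    lt3 k c t.1.2 (pt (g x)) & lt3 k c (pt (g x)) (M t)].
  move=> ts; apply: (gP (A t)); apply/flattenP; exists [:: A t; B t]; last exact: mem_head.
  exact: map_f.
have gB t : t \in s -> exists x, [&& lt3 k e t.1.1 (pt x), lt3 k e (pt x) (hi t.1.1),
    lt3 k c (M t) (pt (g x)) & lt3 k c (pt (g x)) t.2].
  move=> ts; apply: (gP (B t)); apply/flattenP; exists [:: A t; B t]; last by rewrite !inE eqxx orbT.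
  exact: map_f.
have og : ori k true g.
  case: s s2 sv sp lh Mt ord gA gB {lohi hilo gP} => [|t [|t' s]] //= _ _ /andP[].
  case/andP=> tt' _ _ lh Mt ord gA gB.
  have [ts t's] : t \in [:: t, t' & s] /\ t' \in [:: t, t' & s] by rewrite !inE !eqxx orbT.
  have /andP[h1 h2] := ord _ _ ts t's tt'.
  have [x /and4P[_ x1 _ x2]] := gA _ ts; have [y /and4P[y1 y2 y3 y4]] := gB _ ts.
  have [z /and4P[z1 _ z2 _]] := gA _ t's.
  apply: (ori_of_chain (nG _ Gg) (lt3_trans x1 y1) _ (lt3_trans x2 y3)).
    exact: lt3_trans (lt3_trans y2 h1) z1.
  exact: lt3_trans (lt3_trans y4 h2) z2.
exists g; split=> // t ts; have og' := ext_ori HL (nG _ Gg) og.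
have [x /and4P[_ x1 x2 x3]] := gA _ ts; have [y /and4P[y1 _ y2 y3]] := gB _ ts.
have := btw_ori (pt x) (pt y) t.1.1 og'.
rewrite (btw_lt3 _ (lt3_trans x1 y1)) x1 y1 !(ext_pt HL _ (nG _ Gg)).
rewrite (btw_lt3 _ (lt3_trans x3 y2)) => /andP[xa ay].
by rewrite (lt3_trans x2 xa) (lt3_trans ay y3).
Qed.
End Transitivity.

(** * Moving points along a line by conjugates *)

Section LineLemmas.
Context {d : Order.disp_t} {T : orderType d} (k : kind).
Implicit Types (e p q x : T).

Lemma base_notin e p q : lt3 k e p q -> ~~ (is_circ k && btw k p q e).
Proof. ordlia k [:: e; p; q]. Qed.
End LineLemmas.

Section Moves.
Context {k : kind} {d : Order.disp_t} {L : orderType d}.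
Local Notation X := (completion k L).
Implicit Types (x y z : L) (c e p q u v w m : X) (f g h : L -> L) (G H : set (L -> L)).
Hypothesis HL : ample k L.
Local Notation pt := (pt HL).
Variable G : set (L -> L).
Hypothesis G_group : perm_group G.
Hypothesis nG : forall g, G g -> nearly_auto k g.
Hypothesis G_trans : @point_transitive k _ L 2 G.

Definition supp_in h m1 m2 := forall c, ext h c <> c -> btw k m1 m2 c.

(* The element [g] is the inverse of one that takes [a] between [y (6i+2)] and
   [y (6i+3)], and whose images of [p] and [q] enclose the interval between
   [h (y (6i+2))] and [h (y (6i+3))], where the [y j] increase from [w] without
   reaching [h w]. *)
Lemma right_move h c m1 m2 w e k1 k2 (s : seq (X * X * X)) :
  G h -> ori k true h ->
  lt3 k c m1 w -> lt3 k c w (ext h w) -> lt3 k c (ext h w) m2 ->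
  lt3 k e k1 k2 ->
  all (fun t => [&& lt3 k e k1 t.1.1, lt3 k e t.1.2 t.2 & lt3 k e t.2 k2]) s ->
  pairwise (fun t t' => lt3 k e t.1.1 t'.1.1 && lt3 k e t.2 t'.1.2) s ->
  allrel (fun t t' => lt3 k e t.1.1 t'.1.2) s s ->
  exists g gV, [/\ G g, ori k true g, cancel g gV, cancel gV g &
    (forall t, t \in s -> lt3 k e t.1.2 (ext (g \o h \o gV) t.1.1) &&
                          lt3 k e (ext (g \o h \o gV) t.1.1) t.2) /\
    (supp_in h m1 m2 -> supp_in (g \o h \o gV) k1 k2)].
Proof.
move=> Gh oh m1w whw hwm2 k12 /allP sv sp /allrelP sr.
have nh := nG Gh; have oh' := ext_ori HL nh oh.
have [hV [GhV hK hVK]] := perm_groupV G_group Gh.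
have ehVK := ext_can HL (nG GhV) hVK hK; have ehK := ext_can HL nh hK hVK.
(* [z] bounds the room to the right of [w]: it precedes [h w], so that the interval from [w] to [z]
   is disjoint from its image, and [h z] precedes [m2]. *)
have [z /andP[z1 z2]] : exists z, btw k w (ext h w) (pt z) && btw k w (ext hV m2) (pt z).
  apply: btw_nbr; first exact: lt3_ends whw.
  by rewrite -(ends_ori _ _ (can_inj ehK) oh') ehVK; exact: lt3_ends hwm2.
have {z1} /andP[wz zhw] := etrans (esym (btw_lt3 _ whw)) z1.
have {z2} := etrans (btw_ori _ _ _ oh') z2; rewrite ehVK (btw_lt3 _ hwm2) => /andP[hwhz hzm2].
have [y [wyz ylt]] := line_chain HL wz.
have wy i : lt3 k c w (y i) by case/andP: (wyz i).
have yz i : lt3 k c (y i) (pt z) by case/andP: (wyz i).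
have hwy i : lt3 k c (ext h w) (ext h (y i)) && lt3 k c (ext h (y i)) (ext h (pt z)).
  by rewrite -(btw_lt3 _ hwhz) btw_ori // (btw_lt3 _ wz) wy yz.
have hylt i j : (i < j)%N -> lt3 k c (ext h (y i)) (ext h (y j)).
  move=> ij; have := hwy j => /andP[hwj _].
  have : btw k (ext h w) (ext h (y j)) (ext h (y i)).
    by rewrite btw_ori // (btw_lt3 _ (wy j)) wy ylt.
  by rewrite (btw_lt3 _ hwj) => /andP[].
have yhy i j : lt3 k c (y i) (ext h (y j)).
  by apply: lt3_trans (lt3_trans (yz i) zhw) _; case/andP: (hwy j).
have m1y i : lt3 k c m1 (y i) by exact: lt3_trans m1w (wy i).
have hym2 i : lt3 k c (ext h (y i)) m2.
  by apply: lt3_trans hzm2; case/andP: (hwy i).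
(* [m0] and [m3] delimit targets for [k1] and [k2]. Sending [k1] before [m1] and [k2] after [m2]
   confines the support of the conjugate; these two entries also meet the lower bound of [G_trans]
   when [s] is empty. *)
have [m0 m01] := lt3_below HL (lt3_offl m1w).
have [m3 m23] := lt3_above HL (lt3_offr hwm2).
pose n := size s; pose t0 := (w, w, w); pose t i := nth t0 s i.
have ts i : (i < n)%N -> t i \in s by move=> ?; exact: mem_nth.
pose A i := ((t i).1.1, y (6 * i + 2)%N, y (6 * i + 3)%N).
pose P i := ((t i).1.2, ext h (y (6 * i + 0)%N), ext h (y (6 * i + 1)%N)).
pose Q i := ((t i).2, ext h (y (6 * i + 4)%N), ext h (y (6 * i + 5)%N)).
pose sA := [seq A i | i <- iota 0 n].
pose sPQ := flatten [seq [:: P i; Q i] | i <- iota 0 n].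
(* The sources are [k1], all the [a], the [p] and [q] alternately, and [k2]; they are matched with
   [m1], the [y], the images of the [y] under [h], and [m2]. The sources increase because every [a]
   precedes every [p], the targets by [yhy]. *)
pose s' : seq (X * X * X) := (k1, pt m0, m1) :: sA ++ sPQ ++ [:: (k2, m2, pt m3)].
have sAP (v : X * X * X) : v \in sA -> exists2 i, (i < n)%N & v = A i.
  by case/mapP => i; rewrite mem_iota => /andP[_ i_n] ->; exists i.
have sPQP (v : X * X * X) : v \in sPQ -> exists2 i, (i < n)%N & v = P i \/ v = Q i.
  case/flattenP => l /mapP [i]; rewrite mem_iota => /andP[_ i_n] ->.
  by rewrite !inE => /orP[] /eqP ->; exists i; auto.
have tp i j : (i < j < n)%N -> lt3 k e (t i).1.1 (t j).1.1 && lt3 k e (t i).2 (t j).1.2.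
  by case/andP=> ij jn; apply: (pairwiseP t0 sp) => //; rewrite inE // (ltn_trans ij).
have k1t i : (i < n)%N -> lt3 k e k1 (t i).1.1 by move=> /ts/sv/and3P[].
have pqt i : (i < n)%N -> lt3 k e (t i).1.2 (t i).2 by move=> /ts/sv/and3P[].
have tk2 i : (i < n)%N -> lt3 k e (t i).2 k2 by move=> /ts/sv/and3P[].
have apt i j : (i < n)%N -> (j < n)%N -> lt3 k e (t i).1.1 (t j).1.2.
  by move=> i_n j_n; apply: sr; exact: ts.
have m12 : lt3 k c m1 m2 := lt3_trans m1w (lt3_trans whw hwm2).
have k1p i : (i < n)%N -> lt3 k e k1 (t i).1.2.
  by move=> i_n; apply: lt3_trans (k1t i i_n) (apt _ _ i_n i_n).
have m1hy i : lt3 k c m1 (ext h (y i)) := lt3_trans (m1y 0%N) (yhy 0%N i).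
have pk2 i : (i < n)%N -> lt3 k e (t i).1.2 k2.
  by move=> i_n; exact: lt3_trans (pqt i i_n) (tk2 _ i_n).
have [|||g' [Gg' og' g'P]] := @G_trans e c s'.
- by rewrite /= !size_cat addnA addn1.
- apply/allP => v; rewrite inE !mem_cat inE => /orP[/eqP ->|/or3P[/sAP[i i_n ->]|/sPQP|/eqP ->]] /=.
  + by rewrite (lt3_offl k12) m01.
  + by rewrite (lt3_offr (k1t _ i_n)) ylt // ltn_add2l.
  + case=> i i_n [] -> /=.
      by rewrite (lt3_offl (pqt _ i_n)) hylt // ltn_add2l.
    by rewrite (lt3_offr (pqt _ i_n)) hylt // ltn_add2l.
  + by rewrite (lt3_offr k12) m23.
- rewrite pairwise_cons; apply/andP; split.
    apply/allP => v; rewrite !mem_cat inE => /or3P[/sAP[i i_n ->]|/sPQP[i i_n]|/eqP ->] /=.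
    + by rewrite k1t ?m1y.
    + by case=> -> /=; rewrite m1hy ?k1p // (lt3_trans (k1p _ i_n) (pqt _ i_n)).
    + by rewrite k12 m12.
  rewrite !pairwise_cat andbT allrel_catr; apply/and3P; split; last (apply/andP; split).
  + apply/andP; split; apply/allrelP => u v /sAP[i i_n ->].
      case/sPQP => j j_n [] -> /=; rewrite yhy andbT; first exact: apt.
      exact: lt3_trans (apt _ _ i_n j_n) (pqt _ j_n).
    rewrite inE => /eqP -> /=; rewrite (lt3_trans (yhy _ 0%N) (hym2 _)) andbT.
    exact: lt3_trans (apt _ _ i_n i_n) (pk2 _ i_n).
  + rewrite pairwise_map; apply: pairwise_iota => i j ijn /=.
    by have /andP[-> _] := tp _ _ ijn; rewrite ylt // block_lt //; case/andP: ijn.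
  + apply/allrelP => u v /sPQP[i i_n uE]; rewrite inE => /eqP ->.
    by case: uE => -> /=; rewrite hym2 ?pk2 ?tk2.
  apply: pairwise_flatten; rewrite ?all_map ?pairwise_map.
    apply/allP => i; rewrite mem_iota => /andP[_ i_n] /=.
    by rewrite pqt // hylt // ltn_add2l.
  apply: pairwise_iota => i j ijn /=; have /andP[ij j_n] := ijn.
  have i_n := ltn_trans ij j_n.
  have /andP[_ qp] := tp _ _ ijn.
  apply/allrelP => u v; rewrite !inE => /orP[] /eqP -> /orP[] /eqP -> /=.
  + by rewrite (lt3_trans (pqt _ i_n) qp) hylt // block_lt.
  + by rewrite (lt3_trans (pqt _ i_n) (lt3_trans qp (pqt _ j_n))) hylt // block_lt.
  + by rewrite qp hylt // block_lt.
  + by rewrite (lt3_trans qp (pqt _ j_n)) hylt // block_lt.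
have [g [Gg g'K gK]] := perm_groupV G_group Gg'.
have ng' := nG Gg'; have ng := nG Gg; have og := ori_inv gK og'.
have eg'K := ext_can HL ng' g'K gK; have egK := ext_can HL ng gK g'K.
have oeg' := ext_ori HL ng' og'.
exists g, g'; split=> //.
have fE v : ext (g \o h \o g') v = ext g (ext h (ext g' v)).
  by rewrite (ext_comp HL (nearly_auto_comp ng nh) ng') (ext_comp HL ng nh).
split.
  move=> v /(nthP t0) [i i_n <-]; rewrite -/(t i).
  have sAi : A i \in s'.
    by rewrite inE !mem_cat map_f ?orbT // mem_iota.
  have PQs (r : X * X * X) : r \in [:: P i; Q i] -> r \in s'.
    move=> rPQ; rewrite inE !mem_cat; apply/orP; right; apply/orP; right; apply/orP; left.
    by apply/flattenP; exists [:: P i; Q i] => //; apply: map_f; rewrite mem_iota.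
  have /andP[a1 a2] := g'P _ sAi.
  have /andP[_ p2] := g'P _ (PQs (P i) (mem_head _ _)).
  have /andP[q1 _] := g'P _ (PQs (Q i) (mem_last (P i) [:: Q i])).
  have yy : (6 * i + 2 < 6 * i + 3)%N by rewrite ltn_add2l.
  have := btw_ori (y (6 * i + 2)) (y (6 * i + 3)) (ext g' (t i).1.1) oh'.
  rewrite (btw_lt3 _ (ylt _ _ yy)) a1 a2 (btw_lt3 _ (hylt _ _ yy)) => /andP[h1 h2].
  have h3 : lt3 k c (ext g' (t i).1.2) (ext h (ext g' (t i).1.1)).
    by apply: lt3_trans p2 (lt3_trans _ h1); apply: hylt; rewrite ltn_add2l.
  have h4 : lt3 k c (ext h (ext g' (t i).1.1)) (ext g' (t i).2).
    by apply: lt3_trans h2 (lt3_trans _ q1); apply: hylt; rewrite ltn_add2l.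
  have /and3P[_ pq _] := sv _ (ts _ i_n).
  rewrite fE -(btw_lt3 _ pq) -(btw_ori _ _ _ oeg') egK (btw_lt3 _ (lt3_trans h3 h4)).
  by rewrite h3.
move=> hm v; rewrite fE => fv.
have {fv} /hm : ext h (ext g' v) <> ext g' v.
  by move=> E; apply: fv; rewrite E eg'K.
rewrite (btw_lt3 _ m12) => /andP[m1v vm2].
have /andP[_ k1m] := g'P (k1, pt m0, m1) (mem_head _ _).
have /andP[mk2 _] : lt3 k c m2 (ext g' k2) && lt3 k c (ext g' k2) (pt m3).
  by apply: (g'P (k2, m2, pt m3)); rewrite inE !mem_cat inE eqxx !orbT.
rewrite -(btw_ori _ _ _ oeg') (btw_lt3 _ (lt3_trans k1m (lt3_trans m12 mk2))).
by rewrite (lt3_trans k1m m1v) (lt3_trans vm2 mk2).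
Qed.

Lemma supp_in_inv h hV m1 m2 : nearly_auto k h -> cancel h hV -> cancel hV h ->
  supp_in h m1 m2 -> supp_in hV m1 m2.
Proof.
move=> nh hK hVK hm c hc; apply: hm => E; apply: hc.
by rewrite -{1}E (ext_can HL nh hK hVK).
Qed.

Lemma supp_in_comp f h m1 m2 : nearly_auto k f -> nearly_auto k h ->
  supp_in f m1 m2 -> supp_in h m1 m2 -> supp_in (f \o h) m1 m2.
Proof.
move=> nf nh fm hm c fhc; apply: contrapT => nc; apply: fhc.
have fix_ g : supp_in g m1 m2 -> ext g c = c.
  by move=> gm; apply: contrapT => /gm/nc.
by rewrite (ext_comp HL nf nh) /= !fix_.
Qed.

Lemma bounded_eltP h : bounded_elt k h <->
  exists m1 m2, valid_ends k m1 m2 /\ supp_in h m1 m2.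
Proof.
split=> [[_ [m1 [m2 [/endsE m12 ->]]] hm]|[m1 [m2 [/endsE m12 hm]]]].
  by exists m1, m2; split=> // c /hm; rewrite oitvE.
exists (oitv k m1 m2); first by exists m1, m2.
by move=> c /hm; rewrite oitvE.
Qed.

Lemma ends_line p q : valid_ends k p q -> exists e, lt3 k e p q.
Proof.
rewrite /valid_ends /lt3; case ck: (is_circ k) => pq; last by exists p.
have /(btw_ex HL) [z] : valid_ends k q p by rewrite /valid_ends ck eq_sym.
by rewrite /btw ck => qzp; exists (pt z); rewrite -cr_rot.
Qed.

Lemma off2_ex p q : p != q -> exists e, off k e p && off k e q.
Proof.
rewrite /off => pq; case ck: (is_circ k); last by exists p.
have /(btw_ex HL) [z] : valid_ends k p q by rewrite /valid_ends ck.
rewrite /btw ck => pzq; exists (pt z); apply/andP; split; apply/eqP => E.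
  by move: pzq; rewrite E /cr ltxx; case: ltgtP.
by move: pzq; rewrite E /cr ltxx; case: ltgtP.
Qed.

Lemma lt3b_above2 b e p q : off k e p -> off k e q ->
  exists z, lt3b k b e p (pt z) && lt3b k b e q (pt z).
Proof.
move=> ep eq; case: (lt3b_total b ep eq) => [pq|<-|qp].
- by have [z qz] := lt3b_above HL b eq; exists z; rewrite qz (lt3b_trans pq qz).
- by have [z pz] := lt3b_above HL b ep; exists z; rewrite pz.
- by have [z pz] := lt3b_above HL b ep; exists z; rewrite pz (lt3b_trans qp pz).
Qed.

(** Stands in for a normal subgroup whose elements preserve orientation, as [right_move] demands;
    invariance is required only under the orientation-preserving elements of [G]. *)
Record invariant_family H : Prop := InvariantFamily {
  family_sub : forall f, H f -> G f;
  family_ori : forall f, H f -> ori k true f;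
  familyM : forall f h, H f -> H h -> H (f \o h);
  familyV : forall f fV, cancel f fV -> cancel fV f -> H f -> H fV;
  familyJ : forall g gV f, G g -> ori k true g -> cancel g gV -> cancel gV g ->
    H f -> H (g \o f \o gV)
}.

Section Family.
Variable H : set (L -> L).
Hypothesis HH : invariant_family H.

(* A bounded [h] determines the line: it must be cut outside the support. *)
Lemma mover_exists h : H h -> h <> id -> exists f c m1 m2 w,
  [/\ H f, lt3 k c m1 w, lt3 k c w (ext f w), lt3 k c (ext f w) m2 &
      bounded_elt k h -> supp_in f m1 m2].
Proof.
move=> Hh hid; have Gh := family_sub HH Hh; have nh := nG Gh.
have [hV [_ hK hVK]] := perm_groupV G_group Gh; have HhV := familyV HH hK hVK Hh.
have ehK := ext_can HL nh hK hVK; have ehi := can_inj ehK.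
have [x hx] := neq_id_ex hid; pose w := pt x.
have hw : ext h w <> w by rewrite (ext_pt HL _ nh) => /eqP; rewrite pt_eq => /eqP.
have hhw : ext h (ext h w) <> ext h w by move=> /ehi.
have [c [m1 [m2 [m1w wm2 m1hw hwm2 bh]]]] : exists c m1 m2,
    [/\ lt3 k c m1 w, lt3 k c w m2, lt3 k c m1 (ext h w), lt3 k c (ext h w) m2 &
    bounded_elt k h -> supp_in h m1 m2].
  have [/bounded_eltP [m1 [m2 [m12 hm]]]|nb] := pselect (bounded_elt k h).
    have [c cm12] := ends_line m12; exists c, m1, m2.
    have := hm _ hw; have := hm _ hhw; rewrite !(btw_lt3 _ cm12).
    by move=> /andP[? ?] /andP[? ?]; split.
  have [c /andP[cw chw]] : exists e, off k e w && off k e (ext h w).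
    by apply: off2_ex; apply/eqP => /esym.
  have [m1 /andP[h1 h2]] := lt3b_above2 false cw chw.
  have [m2 /andP[h3 h4]] := lt3b_above2 true cw chw.
  by exists c, (pt m1), (pt m2); split.
have [cw chw] := (lt3_offr m1w, lt3_offr m1hw).
case: (lt3_total cw chw) => [whw|/esym//|hww].
  by exists h, c, m1, m2, w.
(* If [h] moves [w] to the left, its inverse moves [h w] to the right. *)
exists hV, c, m1, m2, (ext h w); rewrite ehK; split=> // /bh.
exact: supp_in_inv.
Qed.

(** Between [r] and [k2] there is room beyond all the [a] and [q]. A right move [f1] sends each [a]
    into a slot there, and another one, [f2], sends the corresponding [p] and [q] into the same slot
    on either side of the image of [a]. Then [f1] followed by the inverse of [f2] sends [a] between
    [p] and [q]. *)
Lemma local_move h e k1 k2 (s : seq (X * X * X)) : H h -> h <> id ->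
  lt3 k e k1 k2 ->
  all (fun t => [&& lt3 k e k1 t.1.1, lt3 k e t.1.1 k2, lt3 k e k1 t.1.2,
                    lt3 k e t.1.2 t.2 & lt3 k e t.2 k2]) s ->
  pairwise (fun t t' => lt3 k e t.1.1 t'.1.1 && lt3 k e t.2 t'.1.2) s ->
  exists f, [/\ H f,
    forall t, t \in s -> lt3 k e t.1.2 (ext f t.1.1) && lt3 k e (ext f t.1.1) t.2 &
    bounded_elt k h -> supp_in f k1 k2].
Proof.
move=> Hh hid k12 /allP sv sp.
have [h' [c [m1 [m2 [w [Hh' m1w whw hwm2 bh]]]]]] := mover_exists Hh hid.
have Gh' := family_sub HH Hh'; have oh' := family_ori HH Hh'.
have move_ := right_move Gh' oh' m1w whw hwm2 k12.
have nH f : H f -> nearly_auto k f by move=> /(family_sub HH)/nG.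
have bnd g gV : (supp_in h' m1 m2 -> supp_in (g \o h' \o gV) k1 k2) ->
    bounded_elt k h -> supp_in (g \o h' \o gV) k1 k2 by move=> + /bh; apply.
have conj_ g gV := familyJ HH (g := g) (gV := gV) (f := h').
pose l := k1 :: [seq t.1.1 | t <- s] ++ [seq t.2 | t <- s].
have [r /andP[rk2 /allP rl]] := near_list HL false l (lt3_offr k12).
have k1r : lt3 k e k1 r by have := rl k1 (mem_head _ _); rewrite /= k12.
have ar t : t \in s -> lt3 k e t.1.1 r.
  move=> ts; have /and5P[_ ak2 _ _ _] := sv _ ts.
  by have := rl t.1.1; rewrite /= ak2; apply; rewrite inE mem_cat (map_f (fun t => t.1.1)) ?orbT.
have qr t : t \in s -> lt3 k e t.2 r.
  move=> ts; have /and5P[_ _ _ _ qk2] := sv _ ts.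
  by have := rl t.2; rewrite /= qk2; apply; rewrite inE mem_cat (map_f (fun t => t.2)) ?orbT.
have [u [ru ult]] := line_chain HL rk2.
have ru1 i : lt3 k e r (u i) by case/andP: (ru i).
have uk2 i : lt3 k e (u i) k2 by case/andP: (ru i).
pose t0 := (w, w, w); pose t i := nth t0 s i; pose n := size s.
have ts i : (i < n)%N -> t i \in s by move=> ?; exact: mem_nth.
have tp i j : (i < j < n)%N -> lt3 k e (t i).1.1 (t j).1.1 && lt3 k e (t i).2 (t j).1.2.
  by case/andP=> ij jn; apply: (pairwiseP t0 sp) => //; rewrite inE // (ltn_trans ij).
pose s1 := [seq ((t i).1.1, u (2 * i + 0)%N, u (2 * i + 1)%N) | i <- iota 0 n].
have [|||g1 [g1V [Gg1 og1 g1K g1VK [f1P b1]]]] := move_ s1.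
- apply/allP => v /mapP [i]; rewrite mem_iota => /andP[_ i_n] -> /=.
  have /and5P[-> _ _ _ _] := sv _ (ts _ i_n).
  by rewrite uk2 ult // ltn_add2l.
- rewrite pairwise_map; apply: pairwise_iota => i j ijn /=.
  by have /andP[-> _] := tp _ _ ijn; rewrite ult // block_lt //; case/andP: ijn.
- apply/allrelP => v v' /mapP [i]; rewrite mem_iota => /andP[_ i_n] ->.
  by move=> /mapP [j _ ->] /=; exact: lt3_trans (ar _ (ts _ i_n)) (ru1 _).
set f1 := g1 \o h' \o g1V in f1P b1.
have Hf1 : H f1 by exact: conj_.
have f1t i : (i < n)%N -> lt3 k e (u (2 * i + 0)%N) (ext f1 (t i).1.1) &&
    lt3 k e (ext f1 (t i).1.1) (u (2 * i + 1)%N).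
  move=> i_n; apply: (f1P (_, _, _)); apply/mapP; exists i => //.
  by rewrite mem_iota.
have /choice [M MP] : forall pq : X * X, exists m, lt3 k e pq.1 pq.2 ->
    lt3 k e pq.1 m && lt3 k e m pq.2.
  move=> [p q] /=; have [pq|] := boolP (lt3 k e p q); last by exists p.
  by have [z] := lt3_dense HL pq; exists (pt z).
pose P i := ((t i).1.2, u (2 * i + 0)%N, M (u (2 * i + 0)%N, ext f1 (t i).1.1)).
pose Q i := ((t i).2, M (ext f1 (t i).1.1, u (2 * i + 1)%N), u (2 * i + 1)%N).
pose s2 := flatten [seq [:: P i; Q i] | i <- iota 0 n].
have PQM i : (i < n)%N -> let a' := ext f1 (t i).1.1 in
    (lt3 k e (u (2 * i + 0)%N) (M (u (2 * i + 0)%N, a')) *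
     lt3 k e (M (u (2 * i + 0)%N, a')) a') *
    (lt3 k e a' (M (a', u (2 * i + 1)%N)) *
     lt3 k e (M (a', u (2 * i + 1)%N)) (u (2 * i + 1)%N)).
  by move=> /f1t /andP[/(MP (_, _)) /andP[h1 h2] /(MP (_, _)) /andP[h3 h4]].
have spq i : (i < n)%N -> [/\ lt3 k e k1 (t i).1.2, lt3 k e (t i).1.2 (t i).2 &
    lt3 k e (t i).2 r].
  by move=> i_n; have /and5P[_ _ k1p pq _] := sv _ (ts _ i_n); split=> //; exact/qr/ts.
have [|||g2 [g2V [Gg2 og2 g2K g2VK [f2P b2]]]] := move_ s2.
- apply/allP => v /flattenP [l' /mapP [i]]; rewrite mem_iota => /andP[_ i_n] ->.
  have [[h1 h2] [h3 h4]] := PQM _ i_n; have [k1p pq _] := spq _ i_n.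
  rewrite !inE => /orP[] /eqP -> /=.
    by rewrite k1p h1 (lt3_trans h2) // (lt3_trans h3) // (lt3_trans h4).
  by rewrite (lt3_trans k1p pq) h4 uk2.
- apply: pairwise_flatten; rewrite ?all_map ?pairwise_map.
    apply/allP => i; rewrite mem_iota => /andP[_ i_n] /=.
    have [[h1 h2] [h3 h4]] := PQM _ i_n; have [_ pq _] := spq _ i_n.
    by rewrite pq (lt3_trans h2 h3).
  apply: pairwise_iota => i j ijn /=; have /andP[ij j_n] := ijn.
  have i_n := ltn_trans ij j_n; have /andP[_ qp] := tp _ _ ijn.
  have [[h1 h2] [h3 h4]] := PQM _ i_n; have [_ pq _] := spq _ i_n.
  have [[h1' h2'] [h3' h4']] := PQM _ j_n; have [_ pq' _] := spq _ j_n.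
  have uu : lt3 k e (u (2 * i + 1)%N) (u (2 * j + 0)%N) by rewrite ult // block_lt.
  have Mu : lt3 k e (M (u (2 * i + 0)%N, ext f1 (t i).1.1)) (u (2 * j + 0)%N).
    exact: lt3_trans h2 (lt3_trans h3 (lt3_trans h4 uu)).
  have uM := lt3_trans h1' (lt3_trans h2' h3').
  have [qq pp] := (lt3_trans qp pq', lt3_trans pq qp).
  apply/allrelP => x y; rewrite !inE => /orP[] /eqP -> /orP[] /eqP -> /=.
  + by rewrite pp Mu.
  + by rewrite (lt3_trans pq qq) (lt3_trans Mu uM).
  + by rewrite qp uu.
  + by rewrite qq (lt3_trans uu uM).
- apply/allrelP => x y /flattenP [l1 /mapP [i]]; rewrite mem_iota => /andP[_ i_n] -> xi.
  move=> /flattenP [l2 /mapP [j]]; rewrite mem_iota => /andP[_ j_n] -> yj.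
  have xr : lt3 k e x.1.1 r.
    have [_ pq qr'] := spq _ i_n.
    by move: xi; rewrite !inE => /orP[] /eqP -> /=; rewrite ?(lt3_trans pq).
  apply: lt3_trans xr _; have [[h1 h2] [h3 h4]] := PQM _ j_n.
  move: yj; rewrite !inE => /orP[] /eqP -> //=.
  exact: lt3_trans (ru1 _) (lt3_trans h1 (lt3_trans h2 h3)).
set f2 := g2 \o h' \o g2V in f2P b2.
have Hf2 : H f2 by exact: conj_.
have [f2V [Gf2V f2K f2VK]] := perm_groupV G_group (family_sub HH Hf2).
have Hf2V := familyV HH f2K f2VK Hf2.
exists (f2V \o f1); split; first exact: (familyM HH).
  move=> v /(nthP t0) [i i_n <-]; rewrite -/(t i) (ext_comp HL (nH _ Hf2V) (nH _ Hf1)).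
  have /andP[h1 h2] := f1t _ i_n.
  have s2P (r' : X * X * X) : r' \in [:: P i; Q i] -> r' \in s2.
    by move=> rPQ; apply/flattenP; exists [:: P i; Q i] => //; apply: map_f; rewrite mem_iota.
  have /andP[_ p2] := f2P _ (s2P (P i) (mem_head _ _)).
  have /andP[q1 _] := f2P _ (s2P (Q i) (mem_last (P i) [:: Q i])).
  have /andP[_ m1'] := MP (_, _) h1; have /andP[m2' _] := MP (_, _) h2.
  have /and5P[_ _ _ pq _] := sv _ (ts _ i_n).
  have of2 := ext_ori HL (nH _ Hf2) (family_ori HH Hf2).
  have ef2VK := ext_can HL (nH _ Hf2V) f2VK f2K.
  rewrite -(btw_lt3 _ pq) -(btw_ori _ _ _ of2) /= ef2VK.
  have [h3 h4] := (lt3_trans p2 m1', lt3_trans m2' q1).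
  by rewrite (btw_lt3 _ (lt3_trans h3 h4)) h3.
move=> hb; apply: supp_in_comp; [exact: nH|exact: nH| |exact: bnd b1 hb].
apply: (supp_in_inv (nH _ Hf2) f2K f2VK); exact: bnd b2 hb.
Qed.
End Family.
End Moves.

(** * Normal and subnormal subgroups *)

Section NormalSubgroups.
Context {k : kind} {d : Order.disp_t} {L : orderType d}.
Local Notation X := (completion k L).
Implicit Types (x y z : L) (c e p q u v w m : X) (f g h : L -> L) (G H : set (L -> L)).
Hypothesis HL : ample k L.
Local Notation pt := (pt HL).

Lemma off_sym p q : off k p q = off k q p.
Proof. by rewrite /off eq_sym. Qed.

Lemma line_bound b e (l : seq X) : all (off k e) l ->
  exists w, off k e w && all (lt3b k b e w) l.
Proof.
elim: l => [_|p l IH /= /andP[ep /IH [w /andP[ew wl]]]].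
  by have [w] := off_ex HL e; rewrite off_sym => ew; exists (pt w); rewrite ew.
have bb r s : lt3b k (~~ b) e r s = lt3b k b e s r by case: b {IH wl}.
have [z /andP[pz wz]] := lt3b_above2 HL (~~ b) ep ew.
rewrite !bb in pz wz; have [ez _] := lt3b_off pz.
exists (pt z); rewrite ez pz /=; apply: sub_all wl => s; exact: lt3b_trans.
Qed.

(** Just after a point distinct from both bases, neither base is met for a while. *)
Lemma common_line e c : exists u v, lt3 k e u v && lt3 k c u v.
Proof.
have [u] : exists u, off k e u && off k c u.
  have [->|/(off2_ex HL) [u]] := eqVneq e c.
    by have [u] := off_ex HL c; exists (pt u); rewrite off_sym p.
  by rewrite ![off k u _]off_sym; exists u.
rewrite /off /lt3; case ck: (is_circ k) => /= uec; last first.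
  have [_ [v uv]] := linear_unbounded HL u (negbT ck).
  by exists u, (pt v); rewrite uv.
have [ve vc] : valid_ends k u e /\ valid_ends k u c.
  by rewrite /valid_ends ck; case/andP: uec.
have [z] := btw_nbr HL ve vc; rewrite /btw ck => /andP[uze uzc].
by exists u, (pt z); rewrite cr_rot uze cr_rot uzc.
Qed.

(** The chain [y] provides intermediate slots in an interval common to both lines: [f1] brings the
    points there along the line based at [e], and [f2] takes them to their targets along the line
    based at [c]. *)
Lemma family_transitive G H h : perm_group G -> (forall g, G g -> nearly_auto k g) ->
  @point_transitive k _ L 2 G -> @invariant_family k _ L G H -> H h -> h <> id ->
  @point_transitive k _ L 0 H.
Proof.
move=> gG nG tG HH Hh hid e c s _ /allP sv sp.
have [u [v /andP[euv cuv]]] := common_line e c.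
have [y [uyv ylt]] := line_chain HL euv.
have uyvc i : lt3 k c u (y i) && lt3 k c (y i) v.
  by rewrite -(btw_lt3 _ cuv) (btw_lt3 _ euv).
have yltc i j : (i < j)%N -> lt3 k c (y i) (y j).
  move=> ij; have /andP[uyj _] := uyvc j; have /andP[euyj _] := uyv j.
  have : btw k u (y j) (y i) by rewrite (btw_lt3 _ euyj) ylt //; have /andP[-> _] := uyv i.
  by rewrite (btw_lt3 _ uyj) => /andP[].
pose t0 := (u, u, u); pose t i := nth t0 s i; pose n := size s.
have ts i : (i < n)%N -> t i \in s by move=> ?; exact: mem_nth.
have tp i j : (i < j < n)%N -> lt3 k e (t i).1.1 (t j).1.1 && lt3 k c (t i).2 (t j).1.2.
  by case/andP=> ij jn; apply: (pairwiseP t0 sp) => //; rewrite inE // (ltn_trans ij).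
have ext_lines e' (l : seq X) : all (off k e') l -> exists k1 k2, lt3 k e' k1 k2 /\
    forall x : X, x \in l -> lt3 k e' k1 x && lt3 k e' x k2.
  move=> el; have [k1 /andP[ek1 /allP k1l]] := line_bound true el.
  have : all (off k e') (k1 :: l) by rewrite /= ek1.
  move=> /(line_bound false) [k2 /andP[_ /allP k2l]]; exists k1, k2.
  split=> [|x xl]; first exact: (k2l _ (mem_head _ _)).
  by rewrite [lt3 _ _ _ _](k1l _ xl) [lt3 _ _ _ _](k2l x) // inE xl orbT.
have [|k1 [k2 [k12 kl]]] := ext_lines e (u :: v :: [seq t.1.1 | t <- s]).
  rewrite /= (lt3_offl euv) (lt3_offr euv); apply/allP => x /mapP [t' /sv /andP[? _] ->] //.
have /andP[k1u _] := kl u (mem_head _ _).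
have /andP[_ vk2] : lt3 k e k1 v && lt3 k e v k2 by apply: kl; rewrite !inE eqxx orbT.
have ka i : (i < n)%N -> lt3 k e k1 (t i).1.1 && lt3 k e (t i).1.1 k2.
  by move=> i_n; apply: kl; rewrite !inE (map_f (fun t => t.1.1)) ?orbT // ts.
pose s1 := [seq ((t i).1.1, y (2 * i + 0)%N, y (2 * i + 1)%N) | i <- iota 0 n].
have [||f1 [Hf1 f1P _]] := local_move HL gG nG tG HH Hh hid k12 (s := s1).
- apply/allP => x /mapP [i]; rewrite mem_iota => /andP[_ i_n] -> /=.
  have /andP[-> ->] := ka _ i_n; rewrite ylt ?ltn_add2l //.
  have /andP[uy yv] := uyv (2 * i + 0)%N; have /andP[_ yv'] := uyv (2 * i + 1)%N.
  by rewrite (lt3_trans k1u uy) (lt3_trans yv' vk2).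
- rewrite pairwise_map; apply: pairwise_iota => i j ijn /=.
  by have /andP[-> _] := tp _ _ ijn; rewrite ylt // block_lt //; case/andP: ijn.
have nf1 := nG _ (family_sub HH Hf1).
have {}f1P i : (i < n)%N -> lt3 k e (y (2 * i + 0)%N) (ext f1 (t i).1.1) &&
    lt3 k e (ext f1 (t i).1.1) (y (2 * i + 1)%N).
  by move=> i_n; apply: (f1P (_, _, _)); apply/mapP; exists i; rewrite ?mem_iota.
have {}f1P i : (i < n)%N -> lt3 k c (y (2 * i + 0)%N) (ext f1 (t i).1.1) &&
    lt3 k c (ext f1 (t i).1.1) (y (2 * i + 1)%N).
  move=> /f1P; have i01 : (2 * i + 0 < 2 * i + 1)%N by rewrite ltn_add2l.
  by rewrite -(btw_lt3 _ (ylt _ _ i01)) (btw_lt3 _ (yltc _ _ i01)).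
have [|l1 [l2 [l12 ll]]] := ext_lines c (u :: v :: [seq t.1.2 | t <- s] ++ [seq t.2 | t <- s]).
  rewrite /= (lt3_offl cuv) (lt3_offr cuv) all_cat /=; apply/andP; split; apply/allP => x.
    by case/mapP => t' /sv /andP[_ pq] ->; exact: lt3_offl pq.
  by case/mapP => t' /sv /andP[_ pq] ->; exact: lt3_offr pq.
have /andP[l1u _] := ll u (mem_head _ _).
have /andP[_ vl2] : lt3 k c l1 v && lt3 k c v l2 by apply: ll; rewrite !inE eqxx orbT.
have l1p i : (i < n)%N -> lt3 k c l1 (t i).1.2.
  move=> i_n; suff /andP[] : lt3 k c l1 (t i).1.2 && lt3 k c (t i).1.2 l2 by [].
  by apply: ll; rewrite !inE mem_cat (map_f (fun t => t.1.2)) ?orbT // ts.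
have ql2 i : (i < n)%N -> lt3 k c (t i).2 l2.
  move=> i_n; suff /andP[] : lt3 k c l1 (t i).2 && lt3 k c (t i).2 l2 by [].
  by apply: ll; rewrite !inE mem_cat (map_f (fun t => t.2)) ?orbT // ts.
pose s2 := [seq (ext f1 (t i).1.1, (t i).1.2, (t i).2) | i <- iota 0 n].
have [||f2 [Hf2 f2P _]] := local_move HL gG nG tG HH Hh hid l12 (s := s2).
- apply/allP => x /mapP [i]; rewrite mem_iota => /andP[_ i_n] -> /=.
  have /andP[fy yf] := f1P _ i_n; rewrite l1p // ql2 //.
  have /andP[uy _] := uyvc (2 * i + 0)%N; have /andP[_ yv'] := uyvc (2 * i + 1)%N.
  rewrite (lt3_trans l1u (lt3_trans uy fy)) (lt3_trans yf (lt3_trans yv' vl2)).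
  by have /andP[_ ->] := sv _ (ts _ i_n).
- rewrite pairwise_map; apply: pairwise_iota => i j ijn /=; have /andP[ij j_n] := ijn.
  have /andP[_ ->] := tp _ _ ijn; rewrite andbT.
  have /andP[_ fy] := f1P _ (ltn_trans ij j_n); have /andP[yf _] := f1P _ j_n.
  by apply: lt3_trans fy (lt3_trans _ yf); apply: yltc; rewrite block_lt.
exists (f2 \o f1); split; first exact: (familyM HH).
  exact: family_ori HH _ (familyM HH Hf2 Hf1).
move=> r /(nthP t0) [i i_n <-]; rewrite (ext_comp HL (nG _ (family_sub HH Hf2)) nf1).
by apply: (f2P (_, _, _)); apply/mapP; exists i; rewrite ?mem_iota.
Qed.

Lemma ends_anti (f : X -> X) p q : injective f -> ori k false f ->
  valid_ends k (f q) (f p) = valid_ends k p q.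
Proof.
move=> fi /(_ p q p); rewrite /valid_ends /lt3b /lt3.
by case: (is_circ k) => // _; rewrite (inj_eq fi) eq_sym.
Qed.

Lemma can_unique f g h : cancel f g -> cancel g f -> cancel f h -> h = g.
Proof. by move=> fK gK fh; apply/funext => x; rewrite -{1}(gK x) fh. Qed.

Lemma group_inv G f g : perm_group G -> G f -> cancel f g -> cancel g f -> G g.
Proof.
move=> gG Gf fK gK; have [h [Gh fh _]] := perm_groupV gG Gf.
by rewrite -(can_unique fK gK fh).
Qed.

Lemma normal_refl G : perm_group G -> normal_in G G.
Proof.
move=> gG; split=> // g gV f Gg gK gVK Gf.
by apply: (perm_groupM gG (perm_groupM gG Gg Gf)); exact: group_inv gG Gg gK gVK.
Qed.

Section NormalStep.
Variables G H : set (L -> L).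
Hypothesis gG : perm_group G.
Hypothesis nG : forall g, G g -> nearly_auto k g.
Hypothesis tG : @point_transitive k _ L 2 G.
Hypothesis HG : normal_in H G.

Lemma normal_family : @invariant_family k _ L G [set f | H f /\ ori k true f].
Proof.
have [gH sHG JH] := HG; split.
- by move=> f [/sHG].
- by move=> f [].
- move=> f h [Hf of_] [Hh oh]; split; first exact: (perm_groupM gH).
  exact: (ori_comp of_ oh).
- by move=> f g fK gK [Hf of_]; split; [exact: group_inv fK gK|exact: ori_inv of_].
- move=> g g' f Gg og gK g'K [Hf of_]; split; first exact: JH.
  exact: (ori_comp (ori_comp og of_) (ori_inv g'K og)).
Qed.

(* A reversing [f] does not commute with every element of [G]: otherwise
   [f (g w) = g (f w)], while [g w] and [g (f w)] can be prescribed almost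
   independently. *)
Lemma normal_ori_nontrivial h : H h -> h <> id ->
  exists f, [/\ H f, ori k true f & f <> id].
Proof.
move=> Hh hid; have [gH sHG JH] := HG; have nh := nG (sHG _ Hh).
have [bh [[] oh rb]] := (nearly_autoP k h).1 nh; first by exists h.
have [h' [Hh' hK h'K]] := perm_groupV gH Hh.
have [x hx] := neq_id_ex hid.
(* In the linear kinds [w] must be moved to the right; if [h] moves [x] to the left, its inverse
   moves [h x] to the right. *)
have [f [fV [w [Hf fK fVK of_ wfw]]]] : exists f fV w, [/\ H f, cancel f fV, cancel fV f,
    ori k false f & valid_ends k w (ext f w)].
  have hxx : pt (h x) != pt x by rewrite pt_eq; apply/eqP.
  have [xhx|] := boolP (valid_ends k (pt x) (pt (h x))).
    by exists h, h', (pt x); rewrite (ext_pt HL _ nh); split.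
  move=> nv; exists h', h, (pt (h x)); have nh' := nG (sHG _ Hh').
  rewrite (ext_pt HL _ nh') hK; split=> //; first exact: ori_inv oh.
  by move: nv hxx; rewrite /valid_ends; case: (is_circ k) => //=; case: ltgtP.
have nf := nG (sHG _ Hf); have ofb := ext_ori HL nf of_.
have HfV := group_inv gH Hf fK fVK.
have efK := ext_can HL nf fK fVK; have efVK := ext_can HL (nG (sHG _ HfV)) fVK fK.
have [e ewf] := ends_line HL wfw.
have [r /andP[wr rfw]] := lt3_dense HL ewf; have [r' /andP[rr' r'fw]] := lt3_dense HL rfw.
(* [q] is so close to [w] that it precedes [r] while [f q] follows [r']. With [g w] before [q] and
   [g (f w)] between [r] and [r'], the point [f (g w)] falls after [f q], hence differs from
   [g (f w)]. *)
have [|q /andP[wrq wq]] := btw_nbr HL (lt3_ends wr) (_ : valid_ends k w (ext fV (pt r'))).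
  by rewrite -(ends_anti _ _ (can_inj efK) ofb) efVK; exact: lt3_ends r'fw.
move: wrq; rewrite (btw_lt3 _ wr) => /andP[{}wq' qr].
move: wq; rewrite -(btw_anti _ _ _ ofb) efVK (btw_lt3 _ r'fw) => /andP[r'fq fqfw].
have [|||g [Gg og gP]] := @tG e e [:: (w, w, pt q); (ext f w, pt r, pt r')].
- by [].
- by rewrite /= (lt3_offl ewf) wq' (lt3_offr ewf) rr'.
- by rewrite /= ewf qr.
have /andP[wgw gwq] := gP _ (mem_head _ _).
have /andP[rgf gfr'] := gP _ (mem_last (w, w, pt q) [:: (ext f w, pt r, pt r')]).
have [g' [Gg' gK g'K]] := perm_groupV gG Gg; have ng := nG Gg.
(* A product of two reversing maps preserves orientation; this one is the identity only if [f] and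
   [g] commute. *)
exists (f \o (g \o fV \o g')); split.
- by apply: (perm_groupM gH) => //; exact: JH.
- have og' := ori_inv g'K og; have ofV := ori_inv fVK of_.
  exact: (ori_comp of_ (ori_comp (ori_comp og ofV) og')).
move=> E; have {}E : f \o g = g \o f.
  by apply/funext => z; have := congr1 (fun F => F (g (f z))) E; rewrite /= gK fK.
have : ext f (ext g w) = ext g (ext f w).
  by have := congr1 (fun F => ext F w) E; rewrite (ext_comp HL nf ng) (ext_comp HL ng nf).
have : btw k (ext f (pt q)) (ext f w) (ext f (ext g w)).
  by rewrite btw_anti // (btw_lt3 _ wq') wgw.
rewrite (btw_lt3 _ fqfw) => /andP[h1 _] h2; rewrite h2 in h1.
by have := lt3_trans gfr' (lt3_trans r'fq h1); rewrite lt3_irr.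
Qed.

Lemma normal_transitive h : H h -> h <> id -> @point_transitive k _ L 0 H.
Proof.
move=> /normal_ori_nontrivial H1 /H1 [f [Hf of_ fid]] e c s _ sv sp.
have [g [[Hg og] _ gP]] :=
  family_transitive gG nG tG normal_family (conj Hf of_) fid (leq0n (size s)) sv sp.
by exists g.
Qed.
End NormalStep.

(** Two points beyond the interval are fixed, and on the circle so is a base outside it; a reversing
    map would exchange the order of the two points. *)
Lemma bounded_ori g : nearly_auto k g -> bounded_elt k g -> ori k true g.
Proof.
move=> ng /bounded_eltP [p [q [pq gpq]]].
have [_ [[] // og _]] := (nearly_autoP k g).1 ng; exfalso.
have [e epq] := ends_line HL pq.
have fix_ c : ~~ btw k p q c -> ext g c = c by move=> nc; apply: contrapT => /gpq/(negP nc).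
have [u qu] := lt3_above HL (lt3_offr epq); have [v uv] := lt3_above HL (lt3_offr qu).
have fix_above z : lt3 k e q (pt z) -> ext g (pt z) = pt z.
  by move=> qz; apply: fix_; rewrite (btw_lt3 _ epq) (negbTE (lt3_asym qz)) andbF.
have E : lt3 k (ext g e) (pt u) (pt v) = lt3 k e (pt u) (pt v).
  have := base_notin epq; rewrite /lt3; case: (is_circ k) => //= /fix_ -> //.
have := ext_ori HL ng og e (pt u) (pt v).
rewrite !fix_above ?E /= ?(negbTE (lt3_asym uv)) ?uv //.
exact: lt3_trans qu uv.
Qed.

(* For [g] bounded and [f] in [H] such that the support of [g] and its image
   under [f] are disjoint, the commutator of [g] and [f] is bounded, and agrees
   with [g] on the support of [g]. *)
Lemma normal_bounded G H h : perm_group G -> (forall g, G g -> nearly_auto k g) ->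
  @point_transitive k _ L 2 G -> normal_in H G -> H h -> h <> id ->
  has_bounded k G -> has_bounded k H.
Proof.
move=> gG nG tG HG Hh hid [g [Gg gid bg]].
have [gH sHG JH] := HG; have ng := nG _ Gg.
have [g' [Gg' gK g'K]] := perm_groupV gG Gg.
have /bounded_eltP [p [q [pq gpq]]] := bg.
have [e epq] := ends_line HL pq.
have [t qt] := lt3_above HL (lt3_offr epq).
have [y [qyt ylt]] := line_chain HL qt.
have [|||f [Hf of_ fP]] := @normal_transitive _ _ gG nG tG HG _ Hh hid e e
    [:: (p, y 0%N, y 1%N); (q, y 2%N, y 3%N)].
- by [].
- by rewrite /= (lt3_offl epq) (lt3_offr epq) !ylt.
- by rewrite /= epq ylt.
have /andP[y0fp fpy1] := fP _ (mem_head _ _).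
have /andP[y2fq fqy3] := fP _ (mem_last (p, y 0%N, y 1%N) [:: (q, y 2%N, y 3%N)]).
have nf := nG _ (sHG _ Hf); have [f' [Hf' fK f'K]] := perm_groupV gH Hf.
have nf' := nG _ (sHG _ Hf'); have ng' := nG _ Gg'.
have eg'K := ext_can HL ng' g'K gK; have ef'K := ext_can HL nf' f'K fK.
have fpq : lt3 k e (ext f p) (ext f q).
  exact: lt3_trans fpy1 (lt3_trans (ylt 1%N 2%N isT) y2fq).
have qy0 : lt3 k e q (y 0%N) by case/andP: (qyt 0%N).
have qfp := lt3_trans qy0 y0fp.
have py3 : lt3 k e p (y 3%N).
  exact: lt3_trans epq (lt3_trans qfp (lt3_trans fpq fqy3)).
have fixg c : ~~ btw k p q c -> ext g c = c by move=> nc; apply: contrapT => /gpq/(negP nc).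
have fixg' c : ~~ btw k p q c -> ext g' c = c.
  by move=> /fixg E; rewrite -{1}E (ext_can HL ng gK g'K).
have f'pq c : btw k p q (ext f' c) = btw k (ext f p) (ext f q) c.
  by rewrite -(btw_ori _ _ _ (ext_ori HL nf of_)) ef'K.
pose w := (g \o f \o g') \o f'.
have wE c : ext w c = ext g (ext f (ext g' (ext f' c))).
  have ngf := nearly_auto_comp ng nf.
  by rewrite (ext_comp HL (nearly_auto_comp ngf ng') nf') (ext_comp HL ngf ng')
    (ext_comp HL ng nf).
(* For [c] outside the image of the interval, the preimage of [c] under [f] is fixed by [g'], so
   only the factor [g] acts. *)
have wg c : ~~ btw k (ext f p) (ext f q) c -> ext w c = ext g c.
  by move=> nc; rewrite wE fixg' ?f'pq // ef'K.
exists w; split.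
- by apply: (perm_groupM gH) => //; exact: JH.
- have [x gx] := neq_id_ex gid => w_id.
  have gpx : ext g (pt x) <> pt x by rewrite (ext_pt HL _ ng) => /eqP; rewrite pt_eq => /eqP.
  apply: (gpx); rewrite -wg ?w_id ?ext_id //.
  move: (gpq _ gpx); rewrite (btw_lt3 _ epq) (btw_lt3 _ fpq) => /andP[_ xq].
  by rewrite (negbTE (lt3_asym (lt3_trans xq qfp))).
apply/bounded_eltP; exists p, (y 3%N); split; first exact: lt3_ends py3.
move=> c; rewrite (btw_lt3 _ py3) => wc.
have [|nc] := boolP (btw k (ext f p) (ext f q) c).
  by rewrite (btw_lt3 _ fpq) => /andP[h1 h2]; rewrite (lt3_trans epq (lt3_trans qfp h1)) (lt3_trans h2).
move: wc; rewrite (wg _ nc) => /gpq; rewrite (btw_lt3 _ epq) => /andP[-> cq].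
by rewrite (lt3_trans cq (lt3_trans qfp (lt3_trans fpq fqy3))).
Qed.
End NormalSubgroups.

(** * Ordered tuples of points and intervals, placed along a line *)

Section CyclicTuples.
Context {d : Order.disp_t} {T : orderType d} (k : kind).
Implicit Types (e p q x y z : T).

Lemma cr_before_first l e f x : cr l e f -> cr f x l -> cr e f x.
Proof. ordlia Circular [:: l; e; f; x]. Qed.

Lemma cr_shift_base e x y z : cr e x y -> cr e x z -> cr x y z -> cr e y z.
Proof. ordlia Circular [:: e; x; y; z]. Qed.

Lemma cr_leave p q x y : cr p x q -> ~~ cr p y q -> y != p -> cr p x y.
Proof. ordlia Circular [:: p; q; x; y]. Qed.

Lemma cr_neq x y z : cr x y z -> x != y.
Proof. ordlia Circular [:: x; y; z]. Qed.

Lemma lt3_inside e p q x y : btw k p q x -> btw k x q y ->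
  ~~ (is_circ k && btw k p q e) -> lt3 k e x y.
Proof. ordlia k [:: e; p; q; x; y]. Qed.

Lemma Crs_pick n (J : n.-tuple (set T)) (f : 'I_n -> T) :
  Crs J -> (forall i, tnth J i (f i)) ->
  (forall i j : 'I_n, (i < j)%N -> f i <> f j) /\
  (forall i j l : 'I_n, (i < j)%N -> (j < l)%N -> cr (f i) (f j) (f l)).
Proof.
move=> [_ CJ] Jf; have [|C2 C3] := CJ (mktuple f).
  by move=> i; rewrite tnth_mktuple.
by split=> [i j /C2|i j l ij /(C3 _ _ _ ij)]; rewrite !tnth_mktuple.
Qed.

(** [Crs] speaks of a choice in all the sets at once; the other coordinates are filled with
    arbitrary points of the nonempty sets. *)
Lemma Crs_pick2 n (J : n.-tuple (set T)) (i j : 'I_n) x y :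
  Crs J -> (i < j)%N -> tnth J i x -> tnth J j y -> x <> y.
Proof.
move=> CJ ij Jx Jy; have [/choice [f Jf] _] := CJ.
pose g l := if l == i then x else if l == j then y else f l.
have [|C2 _] := @Crs_pick n J g CJ.
  by move=> l; rewrite /g; case: eqP => [->//|_]; case: eqP => [->//|_].
have := C2 i j ij; rewrite /g eqxx eqxx.
by rewrite -val_eqE gtn_eqF.
Qed.

Lemma Crs_pick3 n (J : n.-tuple (set T)) (i j l : 'I_n) x y z :
  Crs J -> (i < j)%N -> (j < l)%N -> tnth J i x -> tnth J j y -> tnth J l z ->
  cr x y z.
Proof.
move=> CJ ij jl Jx Jy Jz; have [/choice [f Jf] _] := CJ.
pose g m := if m == i then x else if m == j then y else if m == l then z else f m.
have [|_ C3] := @Crs_pick n J g CJ.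
  by move=> m; rewrite /g; do 3?[case: eqP => [->//|_]].
have := C3 i j l ij jl; rewrite /g !eqxx -!val_eqE.
by rewrite (gtn_eqF ij) (gtn_eqF jl) (gtn_eqF (ltn_trans ij jl)).
Qed.

Lemma pairwise_enum_ord n (r : rel 'I_n) :
  (forall i j : 'I_n, (i < j)%N -> r i j) -> pairwise r (enum 'I_n).
Proof.
move=> rP; have : pairwise ltn (map val (enum 'I_n)).
  by rewrite val_enum_ord; apply: pairwise_iota => i j /andP[].
by rewrite pairwise_map; apply: sub_pairwise => i j; exact: rP.
Qed.
End CyclicTuples.

Section Conversions.
Context {k : kind} {d : Order.disp_t} {L : orderType d}.
Local Notation X := (completion k L).
Implicit Types (x y z : L) (c e p q u v w m : X) (f g h : L -> L) (G H : set (L -> L)).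
Hypothesis HL : ample k L.
Local Notation pt := (pt HL).

(** On the circle the base is taken on the arc from the last point back to the first. With at most
    one point there is no such arc, and any base different from that point will do. *)
Lemma ordered_line n (a : n.-tuple X) : ordered k a ->
  exists e, (forall i, off k e (tnth a i)) /\
    forall i j : 'I_n, (i < j)%N -> lt3 k e (tnth a i) (tnth a j).
Proof.
have [_ _ [x0 _]] := HL.
rewrite /ordered /off /lt3; case ck: (is_circ k) => oa; last by exists (pt x0).
case: n a oa => [|[|n]] a [C2 C3]; first by exists (pt x0); split=> -[].
  have [e] := off_ex HL (tnth a ord0); rewrite /off ck => ae.
  by exists (pt e); split=> [i|i j]; rewrite (ord1 i) // (ord1 j).
have vl : valid_ends k (tnth a ord_max) (tnth a ord0).
  by rewrite /valid_ends ck; apply/eqP => /esym; exact: C2.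
have [e] := btw_ex HL vl; rewrite /btw ck => ae; exists (pt e).
have F (i : 'I_n.+2) : (0 < i)%N -> cr (pt e) (tnth a ord0) (tnth a i).
  move=> i0; have [->|im] := eqVneq i ord_max; first by rewrite -cr_rot.
  apply: cr_before_first ae _; apply: C3 => //.
  by rewrite ltn_neqAle -ltnS ltn_ord andbT; exact: im.
have lt (i j : 'I_n.+2) : (i < j)%N -> cr (pt e) (tnth a i) (tnth a j).
  move=> ij; have [i0|i0] := posnP i.
    by rewrite (_ : i = ord0); [apply: F; rewrite -i0|exact: val_inj].
  by apply: cr_shift_base (F i i0) (F j (ltn_trans i0 ij)) (C3 ord0 i j i0 ij).
split=> // i; have [i0|i0] := posnP i.
  have im : (i < n.+1)%N by rewrite i0.
  by have /cr_neq := lt i ord_max im; rewrite eq_sym.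
by have := F _ i0; rewrite cr_rot cr_rot => /cr_neq.
Qed.

Lemma interval_sub (Ib : set X) : is_interval k Ib ->
  exists p q, valid_ends k p q /\ forall v, btw k p q v -> Ib v.
Proof.
have [_ _ [x0 _]] := HL.
case=> [[p [q [/endsE pq ->]]]|->|[ck [p [|] ->]]].
- by exists p, q; split=> // z; rewrite oitvE.
- have [x [y xy]] := lt3_ex HL x0; exists (pt x), (pt y); split=> //.
  by apply: (@lt3_ends _ _ _ (pt x0)); rewrite lt3_pt.
- have [[z zp] _] := linear_unbounded HL p ck; exists (pt z), p.
  by rewrite /valid_ends /btw (negbTE ck); split=> // c /andP[].
- have [_ [z pz]] := linear_unbounded HL p ck; exists p, (pt z).
  by rewrite /valid_ends /btw (negbTE ck); split=> // c /andP[].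
Qed.

Lemma push_right e p q v : btw k p q v -> off k e v ->
  exists z, btw k p q (pt z) && lt3 k e v (pt z).
Proof.
move=> pqv ev; have vq := btw_ends_l pqv.
have [z /andP[z1 z2]] : exists z, btw k v q (pt z) && lt3 k e v (pt z).
  move: ev; rewrite /off /lt3; case ck: (is_circ k) => /= ev; last first.
    have [z] := btw_ex HL vq; rewrite /btw ck => /[dup] /andP[vz _] h.
    by exists z; rewrite h.
  have ve : valid_ends k v e by rewrite /valid_ends ck.
  have [z /andP[z1]] := btw_nbr HL vq ve; rewrite {1}/btw ck => z2.
  by exists z; rewrite z1 cr_rot.
by exists z; rewrite z2 (btw_widenr pqv).
Qed.

Lemma push_left e p q v : btw k p q v -> off k e v ->
  exists z, btw k p q (pt z) && lt3 k e (pt z) v.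
Proof.
move=> pqv ev; have pv := btw_ends_r pqv.
have [z /andP[z1 z2]] : exists z, btw k p v (pt z) && lt3 k e (pt z) v.
  move: ev; rewrite /off /lt3; case ck: (is_circ k) => /= ev; last first.
    have [z] := btw_ex HL pv; rewrite /btw ck => /[dup] /andP[_ zv] h.
    by exists z; rewrite h.
  have ve : valid_ends k e v by rewrite /valid_ends ck eq_sym.
  have [z /andP[z1]] := btw_nbl HL pv ve; rewrite {1}/btw ck => z2.
  by exists z; rewrite z1 z2.
by exists z; rewrite z2 (btw_widenl pqv).
Qed.

(** On the circle [p] or [q] may be the base itself, which is not on the line; hence the passage to
    ends in [L] strictly inside. *)
Lemma subinterval e p q : valid_ends k p q -> ~~ (is_circ k && btw k p q e) ->
  exists x y, [/\ lt3 k e (pt x) (pt y), btw k p q (pt x), btw k p q (pt y) &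
    forall c, lt3 k e (pt x) c && lt3 k e c (pt y) -> btw k p q c].
Proof.
move=> pq epq; have [x pqx] := btw_ex HL pq; have [y xqy] := btw_ex HL (btw_ends_l pqx).
have xy := lt3_inside pqx xqy epq; exists x, y; split=> //.
  exact: btw_widenr pqx xqy.
by move=> c; rewrite -(btw_lt3 _ xy) => xyc; exact: btw_widenr pqx (btw_widenl xqy xyc).
Qed.

Lemma off_inside e p q v : ~~ (is_circ k && btw k p q e) -> btw k p q v -> off k e v.
Proof.
rewrite negb_and /off; case: (is_circ k) => //= epq pqv.
by apply: contraNneq epq => <-.
Qed.

(* Disjoint open intervals are separated along a line as soon as their points
   in [L] are. *)
Lemma line_completion n (p q : 'I_n -> X) e :
  (forall i, ~~ (is_circ k && btw k (p i) (q i) e)) ->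
  (forall i j : 'I_n, (i < j)%N -> forall x y, btw k (p i) (q i) (pt x) ->
     btw k (p j) (q j) (pt y) -> lt3 k e (pt x) (pt y)) ->
  forall i j : 'I_n, (i < j)%N -> forall u v, btw k (p i) (q i) u ->
     btw k (p j) (q j) v -> lt3 k e u v.
Proof.
move=> epq Llt i j ij u v pqu pqv.
have [eu ev] := (off_inside (epq i) pqu, off_inside (epq j) pqv).
have [x /andP[pqx ux]] := push_right pqu eu; have [y /andP[pqy yv]] := push_left pqv ev.
have xy := Llt _ _ ij _ _ pqx pqy.
exact: lt3_trans ux (lt3_trans xy yv).
Qed.

(** On the circle the base is the left end of the first interval. No interval contains it, since an
    open interval around it would meet the first one just after it. Going round from there, the
    first interval precedes all others, and the cyclic order becomes the order of the line. *)
Lemma sets_line n (J : n.-tuple (set L)) (p q : 'I_n -> X) :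
  (forall i, valid_ends k (p i) (q i)) ->
  (forall i z, btw k (p i) (q i) (pt z) -> tnth J i z) ->
  ordered_sets k J ->
  exists e, (forall i, ~~ (is_circ k && btw k (p i) (q i) e)) /\
    forall i j : 'I_n, (i < j)%N -> forall u v, btw k (p i) (q i) u ->
      btw k (p j) (q j) v -> lt3 k e u v.
Proof.
move=> pq pqJ; have [_ _ [x0 _]] := HL.
suff : ordered_sets k J -> exists e, (forall i, ~~ (is_circ k && btw k (p i) (q i) e)) /\
    forall i j : 'I_n, (i < j)%N -> forall x y, btw k (p i) (q i) (pt x) ->
      btw k (p j) (q j) (pt y) -> lt3 k e (pt x) (pt y).
  by move=> lL /lL [e [epq Llt]]; exists e; split=> //; exact: line_completion.
rewrite /ordered_sets; case ck: (is_circ k) => oJ /=; last first.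
  exists (pt x0); split=> // i j ij x y /pqJ Jx /pqJ Jy.
  by rewrite /lt3 ck pt_lt; exact: oJ ij _ _ Jx Jy.
case: n J p q pq pqJ oJ => [|n] J p q pq pqJ oJ; first by exists (pt x0); split=> -[].
have disj (i j : 'I_n.+1) x : (i < j)%N -> btw k (p i) (q i) (pt x) -> btw k (p j) (q j) (pt x) -> False.
  by move=> ij /pqJ Jx /pqJ Jy; have := Crs_pick2 oJ ij Jx Jy.
have np j : ~~ btw k (p j) (q j) (p ord0).
  have [->|j0] := eqVneq j ord0.
    by rewrite /btw ck /cr ltxx; case: ltgtP.
  apply/negP => pqp; have [z /andP[z1 z2]] := btw_nbr HL (pq ord0) (btw_ends_l pqp).
  apply: (disj ord0 j z _ z1 (btw_widenr pqp z2)).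
  by rewrite lt0n; exact: j0.
have first_ (j : 'I_n.+1) x y : (0 < j)%N -> btw k (p ord0) (q ord0) (pt x) ->
    btw k (p j) (q j) (pt y) -> cr (p ord0) (pt x) (pt y).
  move=> j0 pqx pqy; move: (pqx); rewrite /btw ck => /cr_leave; apply.
    have nq : ~~ btw k (p ord0) (q ord0) (pt y).
      by apply/negP => pqy'; exact: (disj ord0 j y).
    by move: nq; rewrite /btw ck.
  by apply: contraNneq (np j) => <-.
exists (p ord0); split=> // i j ij x y pqx pqy; rewrite /lt3 ck.
have [i0|i0] := posnP i.
  have ei : i = ord0 by exact: val_inj.
  by rewrite ei in pqx; apply: first_ pqx pqy; rewrite -i0.
have [z pqz] := btw_ex HL (pq ord0).
apply: cr_shift_base (first_ _ _ _ i0 pqz pqx) (first_ _ _ _ (ltn_trans i0 ij) pqz pqy) _.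
rewrite cr_pt; exact: Crs_pick3 oJ (i0 : (ord0 < i)%N) ij (pqJ _ _ pqz) (pqJ _ _ pqx) (pqJ _ _ pqy).
Qed.

Lemma point_transitive_approx H : @point_transitive k _ L 0 H ->
  highly_approx_o_transitive k H.
Proof.
move=> tH n a J iJ /ordered_line [e [ea alt]] oJ.
have /choice [pq pqP] : forall i, exists pq : X * X, valid_ends k pq.1 pq.2 /\
    forall v, btw k pq.1 pq.2 v -> tnth J i v.
  by move=> i; have [p [q]] := interval_sub (iJ i); exists (p, q).
pose JL := [tuple [set x | tnth J i (pt x)] | i < n].
have [|i z|| c [cpq clt]] := @sets_line n JL (fun i => (pq i).1) (fun i => (pq i).2).
- by move=> i; have [] := pqP i.
- by rewrite tnth_mktuple; have [_] := pqP i; apply.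
- move: oJ; rewrite /ordered_sets; case: (is_circ k) => [[J0 CJ]|iJ'].
    split=> [i|x Jx].
      by rewrite tnth_mktuple; have [pqi Ji] := pqP i; have [z /Ji] := btw_ex HL pqi; exists z.
    have [|C2 C3] := CJ [tuple pt (tnth x i) | i < n].
      by move=> i; rewrite tnth_mktuple; have := Jx i; rewrite tnth_mktuple.
    split=> [i j /C2|i j l ij /(C3 _ _ _ ij)]; rewrite !tnth_mktuple ?cr_pt //.
    by move=> + E; rewrite E.
  by move=> i j ij x y; rewrite !tnth_mktuple /= => Jx /(iJ' _ _ ij _ _ Jx); rewrite pt_lt.
have /choice [t tP] : forall i, exists t : L * L, [/\ lt3 k c (pt t.1) (pt t.2),
    btw k (pq i).1 (pq i).2 (pt t.1), btw k (pq i).1 (pq i).2 (pt t.2) &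
    forall v, lt3 k c (pt t.1) v && lt3 k c v (pt t.2) -> btw k (pq i).1 (pq i).2 v].
  by move=> i; have [x [y]] := subinterval (pqP i).1 (cpq i); exists (x, y).
have [|||g [Hg _ gP]] := @tH e c [seq (tnth a i, pt (t i).1, pt (t i).2) | i <- enum 'I_n].
- by [].
- by apply/allP => r /mapP [i _ ->] /=; have [-> _ _ _] := tP i; rewrite ea.
- rewrite pairwise_map; apply: pairwise_enum_ord => i j ij /=; rewrite alt //=.
  by have [_ _ ti _] := tP i; have [_ tj _ _] := tP j; exact: clt ij _ _ ti tj.
exists g => // i; have [_ Ji] := pqP i; have [_ _ _ ti] := tP i; apply/Ji/ti.
by apply: (gP (_, _, _)); apply/mapP; exists i; rewrite ?mem_enum.
Qed.

(** The induction carries point transitivity instead of interval-transitivity: each step uses it for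
    the larger group and returns it for the smaller one. It starts from [G] seen as a normal
    subgroup of itself, which removes the lower bound on the number of points. *)
Lemma subnormal_facts G H : perm_group G -> (forall g, G g -> nearly_auto k g) ->
  @point_transitive k _ L 2 G -> subnormal G H -> (exists2 h, H h & h <> id) ->
  [/\ perm_group H, H `<=` G, @point_transitive k _ L 0 H &
      has_bounded k G -> has_bounded k H].
Proof.
move=> gG nG tG; elim=> [|{}H G' _ IH HG'] [h Hh hid].
  by split=> //; exact (normal_transitive HL gG nG tG (normal_refl gG) Hh hid).
have [gH sHG' _] := HG'; have [|gG' sG'G tG' bG'] := IH; first by exists h => //; exact: sHG'.
have nG' g : G' g -> nearly_auto k g by move=> /sG'G/nG.
have tG2 : @point_transitive k _ L 2 G' by move=> e c s _; exact: tG'.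
split=> //; first exact: subset_trans sG'G.
  exact (normal_transitive HL gG' nG' tG2 HG' Hh hid).
by move=> /bG' bG; exact (normal_bounded HL gG' nG' tG2 HG' Hh hid bG).
Qed.
End Conversions.

(** * Moves with bounded support *)

Section BoxTuples.
Context {d : Order.disp_t} {T : orderType d}.
Implicit Types (e p q x y z : T).

Lemma Cr_cons_rcons n (a : n.-tuple T) x y : Cr [tuple of x :: rcons a y] ->
  (forall i, cr x (tnth a i) y) /\
  (forall i j : 'I_n, (i < j)%N -> cr x (tnth a i) (tnth a j)).
Proof.
move=> [_ C3].
have E (i : 'I_n) : tnth [tuple of x :: rcons a y] (inord i.+1) = tnth a i.
  rewrite !(tnth_nth x) /= inordK /=; last by rewrite !ltnS ltnW.
  by rewrite nth_rcons size_tuple ltn_ord.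
have E0 : tnth [tuple of x :: rcons a y] ord0 = x by [].
have Em : tnth [tuple of x :: rcons a y] ord_max = y.
  by rewrite (tnth_nth x) /= nth_rcons size_tuple ltnn eqxx.
have v (i : 'I_n) : (inord i.+1 : 'I_n.+2) = i.+1 :> nat.
  by rewrite inordK // !ltnS ltnW.
split=> [i|i j ij].
  by have := C3 ord0 (inord i.+1) ord_max; rewrite E0 E Em v; apply=> //=; rewrite ltnS.
by have := C3 ord0 (inord i.+1) (inord j.+1); rewrite E0 !E !v; apply.
Qed.

Lemma cr_box e p q x : cr q e p -> cr p x q -> cr e p x && cr e x q.
Proof. ordlia Circular [:: e; p; q; x]. Qed.

Lemma cr_out e p q : cr q e p -> ~~ cr p e q.
Proof. ordlia Circular [:: e; p; q]. Qed.
End BoxTuples.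

Section BoundedMoves.
Context {k : kind} {d : Order.disp_t} {L : orderType d}.
Local Notation X := (completion k L).
Implicit Types (x y z : L) (c e u v w m : X) (f g h : L -> L).
Hypothesis HL : ample k L.
Local Notation pt := (pt HL).
Variable G : set (L -> L).
Hypothesis gG : perm_group G.
Hypothesis nG : forall g, G g -> nearly_auto k g.
Hypothesis tG : @point_transitive k _ L 2 G.
Hypothesis bG : has_bounded k G.

Lemma bounded_move e k1 k2 (s : seq (X * X * X)) : lt3 k e k1 k2 ->
  all (fun t => [&& lt3 k e k1 t.1.1, lt3 k e t.1.1 k2, lt3 k e k1 t.1.2,
                    lt3 k e t.1.2 t.2 & lt3 k e t.2 k2]) s ->
  pairwise (fun t t' => lt3 k e t.1.1 t'.1.1 && lt3 k e t.2 t'.1.2) s ->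
  exists f, [/\ G f, ori k true f,
    forall t, t \in s -> lt3 k e t.1.2 (ext f t.1.1) && lt3 k e (ext f t.1.1) t.2 &
    supp_in f k1 k2].
Proof.
move=> k12 sv sp; have [h [Gh hid bh]] := bG.
have oh := bounded_ori HL (nG Gh) bh.
have [f [[Gf of_] fP fs]] := local_move HL gG nG tG
  (normal_family (normal_refl gG)) (conj Gh oh) hid k12 sv sp.
by exists f; split=> //; exact: fs.
Qed.

Lemma box_move n (a p q : 'I_n -> X) e k1 k2 : lt3 k e k1 k2 ->
  (forall i, lt3 k e k1 (a i) && lt3 k e (a i) k2) ->
  (forall i j : 'I_n, (i < j)%N -> lt3 k e (a i) (a j)) ->
  (forall i, valid_ends k (p i) (q i)) ->
  (forall i, ~~ (is_circ k && btw k (p i) (q i) e)) ->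
  (forall i z, btw k (p i) (q i) (pt z) -> btw k k1 k2 (pt z)) ->
  (forall i j : 'I_n, (i < j)%N -> forall x y, btw k (p i) (q i) (pt x) ->
     btw k (p j) (q j) (pt y) -> lt3 k e (pt x) (pt y)) ->
  exists f, [/\ G f, forall i, btw k (p i) (q i) (ext f (a i)) & supp_in f k1 k2].
Proof.
move=> k12 ka alt pq epq pqk pqlt.
have /choice [t tP] : forall i, exists t : L * L, [/\ lt3 k e (pt t.1) (pt t.2),
    btw k (p i) (q i) (pt t.1), btw k (p i) (q i) (pt t.2) &
    forall v, lt3 k e (pt t.1) v && lt3 k e v (pt t.2) -> btw k (p i) (q i) v].
  by move=> i; have [x [y]] := subinterval HL (pq i) (epq i); exists (x, y).
have [||f [Gf _ fP fs]] := @bounded_move e k1 k2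
    [seq (a i, pt (t i).1, pt (t i).2) | i <- enum 'I_n] k12.
- apply/allP => r /mapP [i _ ->] /=; have [tt t1 t2 _] := tP i.
  have /andP[-> ->] := ka i; move: (pqk _ _ t1) (pqk _ _ t2).
  by rewrite !(btw_lt3 _ k12) => /andP[-> _] /andP[_ ->]; rewrite tt.
- rewrite pairwise_map; apply: pairwise_enum_ord => i j ij /=; rewrite alt //=.
  by have [_ _ ti _] := tP i; have [_ tj _ _] := tP j; exact: pqlt ij _ _ ti tj.
exists f; split=> // i; have [_ _ _ ti] := tP i; apply: ti.
by apply: (fP (_, _, _)); apply/mapP; exists i; rewrite ?mem_enum.
Qed.

Lemma Ninterval_ends n (J : n.-tuple (set L)) :
  (forall i, bounded_Ninterval k (tnth J i)) -> exists p q : 'I_n -> X, forall i,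
  [/\ valid_ends k (p i) (q i), bar k (tnth J i) = oitv k (p i) (q i) &
      forall z, tnth J i z <-> btw k (p i) (q i) (pt z)].
Proof.
move=> bJ; have /choice [pq pqP] : forall i, exists pq : X * X,
    endpoints_of k (tnth J i) pq.1 pq.2.
  by move=> i; have [p [q]] := bJ i; exists (p, q).
by exists (fun i => (pq i).1), (fun i => (pq i).2) => i; exact: bar_endpoints.
Qed.

Lemma linear_box n (a : n.-tuple X) (J : n.-tuple (set L)) (K : set L) :
  ~~ is_circ k -> increasing a -> increasing_sets J ->
  (forall i, bounded_Ninterval k (tnth J i)) -> bounded_Ninterval k K ->
  (forall i, bar k K (tnth a i)) -> (forall i, tnth J i `<=` K) ->
  exists g, [/\ G g, forall i, bar k (tnth J i) (ext g (tnth a i)) &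
    supp k g `<=` bar k K].
Proof.
move=> ck ia iJ /Ninterval_ends [p [q pqP]] [k1 [k2 /(bar_endpoints HL) [k12 barK KE]]] aK JK.
have E e u v : lt3 k e u v = (u < v) by rewrite /lt3 (negbTE ck).
have [|||||||f [Gf fP fs]] := @box_move n (tnth a) p q k1 k1 k2.
- by rewrite E; move: k12; rewrite /valid_ends (negbTE ck).
- by move=> i; have := aK i; rewrite barK oitvE !E /btw (negbTE ck).
- by move=> i j ij; rewrite E; exact: ia.
- by move=> i; have [] := pqP i.
- by rewrite (negbTE ck).
- by move=> i z; have [_ _ JE] := pqP i; move=> /JE /JK /KE.
- move=> i j ij x y; have [_ _ JE] := pqP i; have [_ _ JE'] := pqP j.
  by move=> /JE Jx /JE' Jy; rewrite E pt_lt; exact: iJ ij _ _ Jx Jy.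
exists f; split=> [//|i|c].
  by have [_ -> _] := pqP i; rewrite oitvE.
by move=> /fs; rewrite barK oitvE.
Qed.

(** Cutting the circle at a point of [L] outside [K], between its end [k2] and its end [k1], turns
    [K] into a segment of a line. *)
Lemma circular_box n (a : n.-tuple X) (J : n.-tuple (set L)) (K : set L) k1 k2 :
  is_circ k -> (forall i, bounded_Ninterval k (tnth J i)) ->
  endpoints_of k K k1 k2 -> Cr [tuple of k1 :: rcons a k2] ->
  Crs [tuple of [set k1] :: rcons (map (inbar k) J) [set k2]] ->
  exists g, [/\ G g, forall i, bar k (tnth J i) (ext g (tnth a i)) &
    supp k g `<=` bar k K].
Proof.
move=> ck /Ninterval_ends [p [q pqP]] /(bar_endpoints HL) [k12 barK KE].
move=> /Cr_cons_rcons [ak12 aa] [_ CJ].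
have k21 : valid_ends k k2 k1 by move: k12; rewrite /valid_ends ck eq_sym.
have [z0] := btw_ex HL k21; rewrite /btw ck => kz0.
have E e u v : lt3 k e u v = cr e u v by rewrite /lt3 ck.
have B u v w : btw k u v w = cr u w v by rewrite /btw ck.
have pick (f : 'I_n -> L) : (forall i, tnth J i (f i)) ->
    Cr [tuple of k1 :: rcons [tuple pt (f i) | i < n] k2].
  move=> Jf; have : forall i, tnth [tuple pt (f i) | i < n] i = pt (f i).
    by move=> i; rewrite tnth_mktuple.
  move: [tuple _ | i < n] => t tE; apply: CJ => -[m lt_m]; rewrite !(tnth_nth set0) !(tnth_nth k1) /=.
  case: m lt_m => [|m] //= lt_m; rewrite !nth_rcons size_map !size_tuple.
  case: (ltngtP m n) => [mn|nm|_]; last 2 first.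
  - by move: lt_m; rewrite !ltnS leqNgt nm.
  - by [].
  rewrite (nth_map set0) ?size_tuple // -/(nat_of_ord (Ordinal mn)).
  by rewrite -!tnth_nth tE; exact/inbar_pt.
have /choice [f0 Jf0] : forall i, exists x, tnth J i x.
  by move=> i; have [pq _ JE] := pqP i; have [z /JE] := btw_ex HL pq; exists z.
have JK i x : tnth J i x -> cr k1 (pt x) k2.
  move=> Jx; have [|C _] := Cr_cons_rcons (pick (fun l => if l == i then x else f0 l) _).
    by move=> l; case: eqP => [->|].
  by have := C i; rewrite tnth_mktuple eqxx.
have JJ (i j : 'I_n) x y : (i < j)%N -> tnth J i x -> tnth J j y -> cr k1 (pt x) (pt y).
  move=> ij Jx Jy.
  have [|_ C] := Cr_cons_rcons (pick (fun l => if l == i then x else if l == j then y else f0 l) _).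
    by move=> l; case: eqP => [->//|_]; case: eqP => [->|].
  by have := C i j ij; rewrite !tnth_mktuple !eqxx -val_eqE gtn_eqF.
have box v : cr k1 v k2 -> cr (pt z0) k1 v && cr (pt z0) v k2 by exact: cr_box.
have box1 v : cr k1 v k2 -> cr (pt z0) k1 v by case/box/andP.
have [|||||||f [Gf fP fs]] := @box_move n (tnth a) p q (pt z0) k1 k2.
- by rewrite E -cr_rot.
- by move=> i; rewrite !E; exact: box.
- by move=> i j ij; rewrite E; apply: cr_shift_base (box1 _ _) (box1 _ _) (aa _ _ ij).
- by move=> i; have [] := pqP i.
- move=> i; rewrite ck /=; have [_ _ JE] := pqP i; apply/negP => /JE /JK.
  by apply/negP/cr_out.
- by move=> i z; have [_ _ JE] := pqP i; move=> /JE /JK; rewrite B.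
- move=> i j ij x y; have [_ _ JE] := pqP i; have [_ _ JE'] := pqP j.
  move=> /JE Jx /JE' Jy; rewrite E.
  exact: cr_shift_base (box1 _ (JK _ _ Jx)) (box1 _ (JK _ _ Jy)) (JJ _ _ _ _ ij Jx Jy).
exists f; split=> [//|i|c].
  by have [_ -> _] := pqP i; rewrite oitvE.
by move=> /fs; rewrite barK oitvE.
Qed.

Lemma bounded_move1 e k1 k2 b u v : lt3 k e k1 b -> lt3 k e b k2 ->
  lt3 k e k1 u -> lt3 k e u v -> lt3 k e v k2 ->
  exists f, [/\ Bdd1 k G f, lt3 k e u (ext f b) && lt3 k e (ext f b) v & supp_in f k1 k2].
Proof.
move=> k1b bk2 k1u uv vk2; have k12 := lt3_trans k1b bk2.
have [||f [Gf _ fP fs]] := @bounded_move e k1 k2 [:: (b, u, v)] k12.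
- by rewrite /= k1b bk2 k1u uv vk2.
- by [].
exists f; split=> //; last exact: (fP _ (mem_head _ _)).
split=> //; apply/bounded_eltP; exists k1, k2; split=> //; exact: lt3_ends k12.
Qed.

(* The last point is moved inside an interval that avoids the points already in
   place, on the circle cut at the first of these. *)
Lemma circular_nBdd n (a : n.-tuple X) (J : n.-tuple (set L)) :
  is_circ k -> Cr a -> (forall i, bounded_Ninterval k (tnth J i)) -> Crs J ->
  exists2 g, nBdd k n G g & forall i, bar k (tnth J i) (ext g (tnth a i)).
Proof.
move=> ck [C2 C3] /Ninterval_ends [p [q pqP]] CJ.
have E e u v : lt3 k e u v = cr e u v by rewrite /lt3 ck.
have pq i : valid_ends k (p i) (q i) by have [] := pqP i.
have [|i z|| e0 [epq lt_pq]] := @sets_line _ _ _ HL n J p q.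
- exact: pq.
- by have [_ _ JE] := pqP i; move/JE.
- by rewrite /ordered_sets ck.
(* Preservation of orientation is carried along so that the images of all the points keep their
   cyclic order. *)
suff /(_ n (leqnn n)) [g [gn Gg og gP]] : forall m : nat, (m <= n)%N -> exists g,
    [/\ nBdd k m G g, G g, ori k true g &
    forall i : 'I_n, (i < m)%N -> btw k (p i) (q i) (ext g (tnth a i))].
  by exists g => // i; have [_ -> _] := pqP i; rewrite oitvE; exact: gP.
elim=> [_|m IH mn].
  exists id; split=> //; first by exists [tuple] => // -[].
  exact: (perm_group1 gG).
have [g [[s sB gs] Gg og gP]] := IH (ltnW mn); pose i0 := Ordinal mn.
have ng := nG Gg; have og' := ext_ori HL ng og.
have [g' [_ gK g'K]] := perm_groupV gG Gg; have gi := can_inj (ext_can HL ng gK g'K).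
pose a' i := ext g (tnth a i).
have a'neq (i j : 'I_n) : (i < j)%N -> a' i != a' j.
  by move=> /C2 aij; apply/eqP => /gi.
have a'cr (i j l : 'I_n) : (i < j)%N -> (j < l)%N -> cr (a' i) (a' j) (a' l).
  by move=> ij jl; rewrite -E og' /= E; exact: C3.
suff [f [[Gf bf] fb fix_]] : exists f, [/\ Bdd1 k G f, btw k (p i0) (q i0) (ext f (a' i0)) &
    forall i : 'I_n, (i < m)%N -> ext f (a' i) = a' i].
  have nf := nG Gf; have of_ := bounded_ori HL nf bf.
  exists (f \o g); split.
  - exists [tuple of f :: s]; last by rewrite gs.
    by move=> i; case: (unliftP ord0 i) => [j|] ->; rewrite ?tnthS ?tnth0.
  - exact: (perm_groupM gG).
  - exact: (ori_comp of_ og).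
  - move=> i; rewrite ltnS leq_eqVlt (ext_comp HL nf ng) /= -/(a' i) => /predU1P [im|im].
      by rewrite (_ : i = i0) //; exact: val_inj.
    by rewrite fix_ //; exact: gP.
(* When no point is in place yet, the base is any point off the target and different from the point
   to be moved. *)
have [m0|m_gt0] := posnP m.
  have [x pqx] := btw_ex HL (pq i0); have [y xqy] := btw_ex HL (btw_ends_l pqx).
  have yx : valid_ends k (pt y) (pt x).
    by move: xqy; rewrite /btw /valid_ends ck eq_sym => /cr_neq.
  have [e yex ea] : exists2 e, btw k (pt y) (pt x) e & e != a' i0.
    have [z1 yz1x] := btw_ex HL yx.
    have [z1a|] := eqVneq (pt z1) (a' i0); last by exists (pt z1).
    have [z2 yz2] := btw_ex HL (btw_ends_r yz1x).
    exists (pt z2); first exact: btw_widenl yz1x yz2.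
    by rewrite -z1a; move: yz2; rewrite /btw ck cr_rot => /cr_neq.
  have exy : lt3 k e (pt x) (pt y) by rewrite E -cr_rot; move: yex; rewrite /btw ck.
  have ea' : off k e (a' i0) by rewrite /off ck eq_sym.
  have [k1 /andP[k1a k1x]] := lt3b_above2 HL false ea' (lt3_offl exy).
  have [k2 /andP[ak2 yk2]] := lt3b_above2 HL true ea' (lt3_offr exy).
  have [f [Bf fa _]] := bounded_move1 k1a ak2 k1x exy yk2.
  exists f; split=> // [|i]; last by rewrite m0.
  by apply: btw_widenr pqx (btw_widenl xqy _); rewrite (btw_lt3 _ exy).
have ji0 : (m.-1 < n)%N by apply: leq_ltn_trans (leq_pred m) mn.
pose i1 : 'I_n := Ordinal (ltn_trans m_gt0 mn); pose j : 'I_n := Ordinal ji0.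
have jm : (j < m)%N by rewrite /= prednK.
have [x [y [xy pqx pqy pqxy]]] := subinterval HL (pq i0) (epq i0).
have a'x (i : 'I_n) : (i < m)%N -> cr e0 (a' i) (pt x).
  by move=> im; rewrite -E; exact: (lt_pq i i0 im _ _ (gP _ im) pqx).
have exy : lt3 k (a' i1) (pt x) (pt y).
  by rewrite E; apply: cr_chain (a'x i1 m_gt0) _; rewrite -E.
have ea' : off k (a' i1) (a' i0) by rewrite /off ck eq_sym a'neq.
(* [k1] is the last point in place, of index [m.-1], so that the support begins after all points in
   place. If the base is the only one of these, any point preceding both the moved point and its
   target serves. *)
have [k1 [k1a k1x k1P]] : exists k1, [/\ lt3 k (a' i1) k1 (a' i0),
    lt3 k (a' i1) k1 (pt x) &
    forall i : 'I_n, (0 < i < m)%N -> ~~ lt3 k (a' i1) k1 (a' i)].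
  have [j0|j_gt0] := posnP m.-1.
    have [k1 /andP[k1a k1x]] := lt3b_above2 HL false ea' (lt3_offl exy).
    exists (pt k1); split=> // i /andP[i_gt0]; rewrite -(prednK m_gt0) j0 ltnS leqn0.
    by rewrite gtn_eqF.
  exists (a' j); split; rewrite ?E.
  - exact: (a'cr i1 j i0 j_gt0).
  - by apply: cr_chain _ (a'x j jm); rewrite -E; exact: (lt_pq i1 j j_gt0 _ _ (gP i1 m_gt0) (gP j jm)).
  move=> i /andP[i_gt0 im]; have [->|ij] := eqVneq i j; first exact/negbT/lt3_irr.
  apply: lt3_asym; rewrite E; apply: (a'cr i1 i j) => //.
  by rewrite ltn_neqAle ij -ltnS prednK.
have [k2 /andP[ak2 yk2]] := lt3b_above2 HL true ea' (lt3_offr exy).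
have [f [Bf fa fs]] := bounded_move1 k1a ak2 k1x exy yk2.
exists f; split=> // [|i im].
  by apply: pqxy; rewrite -(btw_lt3 _ xy) (btw_lt3 _ exy).
apply: contrapT => /fs; have k12 := lt3_trans k1a ak2.
have [i_0|i_gt0] := posnP i.
  rewrite (_ : i = i1); last exact: val_inj.
  by apply/negP; have := base_notin k12; rewrite ck.
by rewrite (btw_lt3 _ k12) (negbTE (k1P i _)) // i_gt0.
Qed.
End BoundedMoves.

Theorem theorem12p6 (k : kind) (d : Order.disp_t) (L : orderType d)
    (G : set (L -> L)) :
  nearly_ordered_group k G ->
  highly_interval_transitive k G ->
  (forall H : set (L -> L), subnormal G H -> (exists2 h, H h & h <> id) ->
     highly_approx_o_transitive k H /\ (has_bounded k G -> has_bounded k H)) /\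
  (~~ is_circ k -> has_bounded k G ->
   forall (n : nat) (a : n.-tuple (completion k L)) (J : n.-tuple (set L))
     (K : set L),
     increasing a -> increasing_sets J ->
     (forall i, bounded_Ninterval k (tnth J i)) ->
     bounded_Ninterval k K ->
     (forall i, bar k K (tnth a i)) ->
     (forall i, tnth J i `<=` K) ->
     exists g, [/\ G g,
       forall i, bar k (tnth J i) (ext g (tnth a i)) &
       supp k g `<=` bar k K]) /\
  (is_circ k -> has_bounded k G ->
   forall (n : nat) (a : n.-tuple (completion k L)) (J : n.-tuple (set L)),
     Cr a -> (forall i, bounded_Ninterval k (tnth J i)) -> Crs J ->
     (forall (K : set L) (cw ccw : completion k L),
        endpoints_of k K cw ccw ->
        Cr [tuple of cw :: rcons a ccw] ->
        Crs [tuple of [set cw] :: rcons (map (inbar k) J) [set ccw]] ->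
        exists g, [/\ G g,
          forall i, bar k (tnth J i) (ext g (tnth a i)) &
          supp k g `<=` bar k K]) /\
     (exists2 g, nBdd k n G g &
        forall i, bar k (tnth J i) (ext g (tnth a i)))).

Proof.
move=> [dL eL gG nG] hG.
(* With at most one point the identity is the only map, so neither a nontrivial [H] nor a
   nonidentity bounded element exists. *)
have [L2|L1] := pselect (exists x y : L, x < y); last first.
  have all_id (g : L -> L) : g = id.
    apply/funext => x; case: (ltgtP (g x) x) => // gx; case: L1.
      by exists (g x), x.
    by exists x, (g x).
  have nb : ~ has_bounded k G by case=> g [_ /(_ (all_id g))].
  by split=> [H _ [h _ /(_ (all_id h))]//|]; split=> _ /nb.
have HL : ample k L by split.
have tG := interval_point_transitive HL nG hG.
split=> [H nH ntH|].
  have [_ _ tH bH] := subnormal_facts HL gG nG tG nH ntH.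
  by split=> //; exact: point_transitive_approx tH.
split=> [ck bG n a J K ia iJ bJ bK aK JK|ck bG n a J Ca bJ CJ].
  exact: (linear_box HL gG nG tG bG ck ia iJ bJ bK aK JK).
split=> [K cw ccw eK CaK CJK|].
  exact: (circular_box HL gG nG tG bG ck bJ eK CaK CJK).
exact: (circular_nBdd HL gG nG tG bG ck Ca bJ CJ).
Qed.
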